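(* Let $R$ be any $1$-dimensional local ring of prime characteristic $p$. Then the ring of Witt vectors $W(R^\infty)$ is not coherent (regardless of whether $R^\infty$ is coherent).
   Context: Local rings are noetherian. The perfect closure of $R$ is $R^\infty=\varinjlim(R\xrightarrow{F}R\xrightarrow{F}\cdots)$, where $F(x)=x^p$. For a perfect ring $A$ of characteristic $p$, $W(A)$ denotes the ring of ($p$-typical) Witt vectors of $A$, which is $p$-torsion-free and $p$-adically complete with $W(A)/pW(A)\simeq A$. A ring is coherent if each of its finitely generated ideals is finitely presented. *)

(* Defs.v *)
From HB Require Import structures.
From mathcomp Require Import all_boot all_order all_algebra finmap zify ring.
From mathcomp Require Import boolp classical_sets.
From mathcomp Require Import monalg.

Set Implicit Arguments.
Unset Strict Implicit.
Unset Printing Implicit Defensive.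

Import GRing.Theory.

Local Open Scope classical_set_scope.
Local Open Scope ring_scope.
Local Open Scope quotient_scope.

Section Finiteness.
Context (R : comNzRingType).

Definition lincomb (M : lmodType R) n (s : 'I_n -> M) (c : 'rV[R]_n) : M :=
  \sum_(i < n) c 0 i *: s i.

Definition finitely_generated (M : lmodType R) (S : set M) : Prop :=
  exists n (s : 'I_n -> M), S = range (lincomb s).

(* There is an exact sequence R^m -> R^n -> S -> 0. *)
Definition finitely_presented (M : lmodType R) (S : set M) : Prop :=
  exists n (s : 'I_n -> M),
    S = range (lincomb s) /\
    finitely_generated [set c : 'rV[R]_n | lincomb s c = 0].

(* Ideals, possibly not proper, are the submodules of the regular module R^o. *)
Definition noetherian : Prop :=
  forall I : set R^o, GRing.submod_closed [in I] -> finitely_generated I.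

Definition coherent : Prop :=
  forall I : set R^o, finitely_generated I -> finitely_presented I.

(* [idealr_closed] is the library's notion of a proper ideal. *)
Definition maximal_ideal (m : set R) : Prop :=
  idealr_closed [in m] /\
  forall I : set R, idealr_closed [in I] -> m `<=` I -> I = m.

Definition local_ring : Prop := exists! m : set R, maximal_ideal m.

Definition prime_ideal (P : set R) : Prop :=
  idealr_closed [in P] /\ prime_idealr_closed [in P].

Definition prime_chain n (P : nat -> set R) : Prop :=
  (forall i, (i <= n)%N -> prime_ideal (P i)) /\
  (forall i, (i < n)%N -> P i `<` P i.+1).

Definition krull_dim_eq n : Prop :=
  (exists P, prime_chain n P) /\ (forall m P, prime_chain m P -> (m <= n)%N).

End Finiteness.

Section Colimit.
Context (R : comNzRingType) (f : {rmorphism R -> R}).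

(* colim is the direct limit of R -f-> R -f-> R -f-> ... ; the pair (m, x)
   stands for the image in it of the element x of the m-th copy of R. *)
Definition colim_rel : rel (nat * R) := fun u v =>
  `[< exists k, iter (v.1 + k) f u.2 = iter (u.1 + k) f v.2 >].

Let iterfM n : {morph iter n f : x y / x * y}.
Proof. by elim: n => [|n IH] x y //; rewrite !iterS IH rmorphM. Qed.
Let iterfD n : {morph iter n f : x y / x + y}.
Proof. by elim: n => [|n IH] x y //; rewrite !iterS IH rmorphD. Qed.
Let iterfN n : {morph iter n f : x / - x}.
Proof. by elim: n => [|n IH] x //; rewrite !iterS IH rmorphN. Qed.
Let iterf0 n : iter n f 0 = 0.
Proof. by elim: n => //= n ->; rewrite rmorph0. Qed.
Let iterf1 n : iter n f 1 = 1.
Proof. by elim: n => //= n ->; rewrite rmorph1. Qed.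

Lemma colim_rel_refl : reflexive colim_rel.
Proof. by move=> u; apply/asboolP; exists 0. Qed.

Lemma colim_rel_sym : symmetric colim_rel.
Proof. by move=> u v; apply/asboolP/asboolP => -[k e]; exists k. Qed.

Lemma colim_rel_trans : transitive colim_rel.
Proof.
move=> v u w /asboolP[k e1] /asboolP[l e2]; apply/asboolP.
exists (v.1 + k + l)%N.
have -> : (w.1 + (v.1 + k + l) = (w.1 + l) + (v.1 + k))%N by lia.
have -> : (u.1 + (v.1 + k + l) = (u.1 + k) + (v.1 + l))%N by lia.
by rewrite iterD e1 -iterD addnC iterD e2 -iterD addnC.
Qed.

Canonical colim_equiv :=
  EquivRel colim_rel colim_rel_refl colim_rel_sym colim_rel_trans.

Definition colim : Type := {eq_quot colim_equiv}.

HB.instance Definition _ := Choice.on colim.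
HB.instance Definition _ := EqQuotient.on colim.

Definition colim_in (m : nat) (x : R) : colim := \pi_colim (m, x).

Lemma colim_in_eq m x n y :
  colim_in m x = colim_in n y <->
  exists k, iter (n + k) f x = iter (m + k) f y.
Proof.
split; first by move/eqmodP/asboolP.
by move=> h; apply/eqmodP/asboolP.
Qed.

Lemma colim_in_lift k m x : colim_in (k + m) (iter k f x) = colim_in m x.
Proof. by apply/colim_in_eq; exists 0; rewrite !addn0 -iterD addnC. Qed.

Lemma colim_inP (u : colim) : exists m x, u = colim_in m x.
Proof. by exists (repr u).1, (repr u).2; rewrite /colim_in -surjective_pairing reprK. Qed.

Definition colim_add (u v : colim) : colim :=
  let: (m, x) := repr u in let: (n, y) := repr v in
  colim_in (m + n) (iter n f x + iter m f y).
Definition colim_mul (u v : colim) : colim :=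
  let: (m, x) := repr u in let: (n, y) := repr v in
  colim_in (m + n) (iter n f x * iter m f y).
Definition colim_opp (u : colim) : colim :=
  let: (m, x) := repr u in colim_in m (- x).

Lemma colim_in_repr m x : exists n y k,
  repr (colim_in m x) = (n, y) /\ iter (n + k) f x = iter (m + k) f y.
Proof.
case E: (repr (colim_in m x)) => [n y]; exists n, y.
have /colim_in_eq[k e] : colim_in m x = colim_in n y by rewrite /colim_in -E reprK.
by exists k.
Qed.

Let iterC m n x : iter m f (iter n f x) = iter n f (iter m f x).
Proof. by rewrite -!iterD addnC. Qed.

Let colim_op2 (op : R -> R -> R) (opM : forall n, {morph iter n f : x y / op x y})
    m x y m1 x1 k1 m2 y2 k2 :
  iter (m1 + k1) f x = iter (m + k1) f x1 ->
  iter (m2 + k2) f y = iter (m + k2) f y2 ->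
  colim_in (m1 + m2) (op (iter m2 f x1) (iter m1 f y2)) = colim_in m (op x y).
Proof.
move=> e1 e2; apply/colim_in_eq; exists (k1 + k2)%N; rewrite !opM.
rewrite -!iterD; congr op.
  have -> : (m + (k1 + k2) + m2 = (m2 + k2) + (m + k1))%N by lia.
  by rewrite iterD -e1 -iterD; congr iter; lia.
have -> : (m + (k1 + k2) + m1 = (m1 + k1) + (m + k2))%N by lia.
by rewrite iterD -e2 -iterD; congr iter; lia.
Qed.

Lemma colim_in_addE m x y :
  colim_add (colim_in m x) (colim_in m y) = colim_in m (x + y).
Proof.
rewrite /colim_add.
have [m1 [x1 [k1 [-> e1]]]] := colim_in_repr m x.
have [m2 [y2 [k2 [-> e2]]]] := colim_in_repr m y.
exact: (colim_op2 iterfD e1 e2).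
Qed.

Lemma colim_in_mulE m x y :
  colim_mul (colim_in m x) (colim_in m y) = colim_in m (x * y).
Proof.
rewrite /colim_mul.
have [m1 [x1 [k1 [-> e1]]]] := colim_in_repr m x.
have [m2 [y2 [k2 [-> e2]]]] := colim_in_repr m y.
exact: (colim_op2 iterfM e1 e2).
Qed.

Lemma colim_in_oppE m x : colim_opp (colim_in m x) = colim_in m (- x).
Proof.
rewrite /colim_opp.
have [m1 [x1 [k1 [-> e1]]]] := colim_in_repr m x.
by apply/colim_in_eq; exists k1; rewrite !iterfN e1.
Qed.

Lemma colim_in3P (u v w : colim) : exists m x y z,
  [/\ u = colim_in m x, v = colim_in m y & w = colim_in m z].
Proof.
have [m [x ->]] := colim_inP u; have [n [y ->]] := colim_inP v.
have [l [z ->]] := colim_inP w.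
exists (m + n + l)%N, (iter (n + l) f x), (iter (m + l) f y), (iter (m + n) f z).
split; rewrite -?colim_in_lift //.
- by rewrite -(colim_in_lift (n + l)) addnC addnA.
- by rewrite -(colim_in_lift (m + l)) addnAC.
- by rewrite -(colim_in_lift (m + n)).
Qed.

Definition colim_zero : colim := colim_in 0 0.
Definition colim_one : colim := colim_in 0 1.

Lemma colim_zeroE m : colim_zero = colim_in m 0.
Proof. by rewrite /colim_zero -(colim_in_lift m) iterf0 addn0. Qed.
Lemma colim_oneE m : colim_one = colim_in m 1.
Proof. by rewrite /colim_one -(colim_in_lift m) iterf1 addn0. Qed.

Let colim_addA : associative colim_add.
Proof.
move=> u v w; have [m [x [y [z [-> -> ->]]]]] := colim_in3P u v w.
by rewrite !colim_in_addE addrA.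
Qed.
Let colim_addC : commutative colim_add.
Proof.
move=> u v; have [m [x [y [_ [-> -> _]]]]] := colim_in3P u v v.
by rewrite !colim_in_addE addrC.
Qed.
Let colim_add0 : left_id colim_zero colim_add.
Proof. by move=> u; have [m [x ->]] := colim_inP u; rewrite (colim_zeroE m) colim_in_addE add0r. Qed.
Let colim_addN : left_inverse colim_zero colim_opp colim_add.
Proof.
by move=> u; have [m [x ->]] := colim_inP u; rewrite (colim_zeroE m) colim_in_oppE colim_in_addE addNr.
Qed.
HB.instance Definition _ := GRing.isZmodule.Build colim
  colim_addA colim_addC colim_add0 colim_addN.

Let colim_mulA : associative colim_mul.
Proof.
move=> u v w; have [m [x [y [z [-> -> ->]]]]] := colim_in3P u v w.
by rewrite !colim_in_mulE mulrA.
Qed.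
Let colim_mulC : commutative colim_mul.
Proof.
move=> u v; have [m [x [y [_ [-> -> _]]]]] := colim_in3P u v v.
by rewrite !colim_in_mulE mulrC.
Qed.
Let colim_mul1 : left_id colim_one colim_mul.
Proof. by move=> u; have [m [x ->]] := colim_inP u; rewrite (colim_oneE m) colim_in_mulE mul1r. Qed.
Let colim_mulD : left_distributive colim_mul +%R.
Proof.
move=> u v w; have [m [x [y [z [-> -> ->]]]]] := colim_in3P u v w.
by rewrite /+%R /= !(colim_in_mulE, colim_in_addE) mulrDl.
Qed.
Let colim_one_neq0 : colim_one != 0 :> colim.
Proof.
by apply/eqP => /colim_in_eq[k]; rewrite iterf1 iterf0 => /eqP; rewrite oner_eq0.
Qed.
HB.instance Definition _ := GRing.Zmodule_isComNzRing.Build colim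
  colim_mulA colim_mulC colim_mul1 colim_mulD colim_one_neq0.

Lemma colim_inD m x y : colim_in m (x + y) = colim_in m x + colim_in m y.
Proof. by rewrite -colim_in_addE. Qed.
Lemma colim_inM m x y : colim_in m (x * y) = colim_in m x * colim_in m y.
Proof. by rewrite -colim_in_mulE. Qed.
Lemma colim_in1 m : colim_in m 1 = 1.
Proof. by rewrite -colim_oneE. Qed.

End Colimit.

Definition perfect_closure (R : comNzRingType) (p : nat) (chRp : p \in [pchar R]) :=
  colim (pFrobenius_aut chRp).
HB.instance Definition _ (R : comNzRingType) (p : nat) (chRp : p \in [pchar R]) :=
  GRing.ComNzRing.on (perfect_closure chRp).

(* Z[X_i | i : I] *)
Definition Zpoly (I : choiceType) := {malg int[{cmonom I}]}.
HB.instance Definition _ (I : choiceType) := GRing.ComNzRing.on (Zpoly I).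

HB.lock Definition Zvar (I : choiceType) (i : I) : Zpoly I := << ucm i >>.

Section ZpolyEval.
Context (I : choiceType).

Definition cmonom_eval (A : comNzRingType) (v : I -> A) (m : {cmonom I}) : A :=
  \prod_(i <- finsupp m) v i ^+ m i.

Definition Zeval (A : comNzRingType) (v : I -> A) : Zpoly I -> A :=
  mmap (intmul 1) (cmonom_eval v).

Lemma cmonom_evalw (A : comNzRingType) (v : I -> A) (m : {cmonom I}) (d : {fset I}) :
  (finsupp m `<=` d)%fset -> cmonom_eval v m = \prod_(i <- d) v i ^+ m i.
Proof.
move=> le; rewrite /cmonom_eval; apply: big_fset_incl => // i _.
by rewrite -cmE_eq0 => /eqP->.
Qed.

Lemma cmonom_eval_mmorphism (A : comNzRingType) (v : I -> A) :
  mmorphism (cmonom_eval v).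
Proof.
split=> [m1 m2|]; last by rewrite /cmonom_eval mdom1 big_seq_fset0.
rewrite (@cmonom_evalw _ v (mmul m1 m2) (finsupp m1 `|` finsupp m2)%fset) ?mdomD //.
rewrite (@cmonom_evalw _ v m1 (finsupp m1 `|` finsupp m2)%fset) ?fsubsetUl //.
rewrite (@cmonom_evalw _ v m2 (finsupp m1 `|` finsupp m2)%fset) ?fsubsetUr //.
by rewrite -big_split; apply: eq_bigr => i _; rewrite cmM exprD.
Qed.
HB.instance Definition _ (A : comNzRingType) (v : I -> A) :=
  isMultiplicative.Build _ _ (cmonom_eval v) (cmonom_eval_mmorphism v).

HB.instance Definition _ (A : comNzRingType) (v : I -> A) :=
  GRing.RMorphism.copy (Zeval v)
    (mmap (intmul 1 : {rmorphism int -> A}) (cmonom_eval v : {mmorphism {cmonom I} -> A})).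
End ZpolyEval.

Section ZpolyTheory.
Context (I : choiceType).
Implicit Types P Q : Zpoly I.

Lemma Zeval_var (A : comNzRingType) (v : I -> A) i : Zeval v (Zvar i) = v i.
Proof.
rewrite /Zeval Zvar.unlock mmapU mul1r /cmonom_eval mdomU big_seq_fset1.
by rewrite cmUU.
Qed.

Lemma Zeval_morph (A B : comNzRingType) (g : {rmorphism A -> B}) (v : I -> A) P :
  g (Zeval v P) = Zeval (g \o v) P.
Proof.
rewrite /Zeval !mmapE rmorph_sum; apply: eq_bigr => k _.
rewrite rmorphM rmorph_int /cmonom_eval rmorph_prod; congr (_ * _).
by apply: eq_bigr => i _; rewrite rmorphXn.
Qed.

Lemma Zeval_ext (A : comNzRingType) (v w : I -> A) P :
  v =1 w -> Zeval v P = Zeval w P.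
Proof. by move=> /funext ->. Qed.

Lemma ZmonomM (a b : int) (k l : {cmonom I}) :
  << a *g k >> * << b *g l >> = << a * b *g mmul k l >> :> Zpoly I.
Proof. exact: fgmulUU. Qed.

Lemma cmonom_eval_Zvar (m : {cmonom I}) : cmonom_eval (@Zvar I) m = << m >> :> Zpoly I.
Proof.
have H (r : seq I) : uniq r -> exists m' : {cmonom I},
    \prod_(i <- r) Zvar i ^+ m i = << m' >> :> Zpoly I /\
    forall j, m' j = ((j \in r) * m j)%N.
  elim: r => [_|i r IH /= /andP[ir /IH[m' [e h]]]].
    by exists mone; rewrite big_nil; split=> // j; rewrite cm1.
  have [m1 [e1 h1]] : exists m1 : {cmonom I},
      Zvar i ^+ m i = << m1 >> :> Zpoly I /\ forall j, m1 j = ((j == i) * m i)%N.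
    elim: (m i) => [|n [m1 [e1 h1]]].
      by exists mone; rewrite expr0; split=> [|j]; [reflexivity|rewrite cm1 muln0].
    exists (mmul (ucm i) m1); split; first by (rewrite exprS e1 Zvar.unlock; exact: ZmonomM).
    by move=> j; rewrite cmM cmU h1 eq_sym; case: eqP => _ /=; rewrite ?mul1n.
  exists (mmul m1 m'); split; first by (rewrite big_cons e e1; exact: ZmonomM).
  move=> j; rewrite cmM h1 h inE; case: eqP => [->|_] /=; last by [].
  by rewrite (negbTE ir) addn0.
have [m' [e h]] := H (finsupp m) (fset_uniq _).
rewrite /cmonom_eval e; congr << _ >>; apply/eqP/cmP => j; rewrite h.
by case: mdomP => //; rewrite ?mul1n.
Qed.

Lemma Zeval_id P : Zeval (@Zvar I) P = P.
Proof.
rewrite [in RHS](monalgE P) /Zeval mmapE; apply: eq_bigr => k _.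
rewrite cmonom_eval_Zvar -[in RHS](mulr1 P@_k).
have -> : (P@_k)%:~R = (P@_k)%:MP :> Zpoly I.
  by rewrite -[in RHS](intz P@_k) rmorph_int.
by rewrite malgM_def fgmulUU mul1m.
Qed.

Lemma Zpoly_ind (T : Zpoly I -> Prop) :
  T 1 -> (forall i, T (Zvar i)) -> (forall P Q, T P -> T Q -> T (P - Q)) ->
  (forall P Q, T P -> T Q -> T (P * Q)) -> forall P, T P.
Proof.
move=> T1 TX TB TM P; have T0 : T 0 by rewrite -(subrr 1); exact: TB.
have TN Q : T Q -> T (- Q) by move=> TQ; rewrite -sub0r; exact: TB.
have TD Q Q' : T Q -> T Q' -> T (Q + Q').
  by move=> TQ TQ'; rewrite -[Q']opprK; apply: TB => //; exact: TN.
have TXn Q n : T Q -> T (Q ^+ n).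
  by move=> TQ; elim: n => [//|n IH]; rewrite exprS; exact: TM.
have Tn n : T n%:R by elim: n => [//|n IH]; rewrite -natr1; exact: TD.
have Tz (c : int) : T c%:~R.
  by case: c => n; [exact: Tn | rewrite NegzE rmorphN; exact/TN/Tn].
rewrite -(Zeval_id P) /Zeval mmapE; apply: (big_ind T T0 TD) => k _.
apply: (TM); first exact: Tz.
apply: (big_ind T T1 TM) => i _; exact: (TXn _ _ (TX i)).
Qed.

(* The coefficientwise quotient; it is only used when d divides every
   coefficient, and then d%:R * Zpoly_div P d = P. *)
Definition Zpoly_div P (d : nat) : Zpoly I :=
  [malg k in msupp P => (P@_k %/ d)%Z].

Lemma Zpoly_divK (d : nat) Q : (0 < d)%N -> Zpoly_div (d%:R * Q) d = Q.
Proof.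
move=> d0; apply/malgP => k; rewrite mcoeffE.
have e : (d%:R * Q)@_k = Q@_k * d%:Z.
  by rewrite mulr_natl mcoeffMn -mulr_natr natz.
have dz : d%:Z != 0 by lia.
case: ifP => [_|/negbT /mcoeff_outdom]; rewrite e; first by rewrite mulzK.
by move/eqP; rewrite mulf_eq0 (negbTE dz) orbF => /eqP->.
Qed.

Lemma Zpoly_natI (d : nat) P Q : (0 < d)%N -> d%:R * P = d%:R * Q -> P = Q.
Proof. by move=> d0 e; rewrite -(Zpoly_divK P d0) e Zpoly_divK. Qed.

End ZpolyTheory.

Section Congruence.
Context (B : comNzRingType).
Implicit Types x y z : B.

Definition congm (d : nat) x y := exists z, x = y + d%:R * z.

Lemma congm_refl d x : congm d x x.
Proof. by exists 0; rewrite mulr0 addr0. Qed.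
Lemma congm_sym d x y : congm d x y -> congm d y x.
Proof. by move=> [z ->]; exists (- z); ring. Qed.
Lemma congm_trans d y x z : congm d x y -> congm d y z -> congm d x z.
Proof. by move=> [u ->] [v ->]; exists (u + v); ring. Qed.
Lemma congmD d x y x' y' : congm d x y -> congm d x' y' -> congm d (x + x') (y + y').
Proof. by move=> [u ->] [v ->]; exists (u + v); ring. Qed.
Lemma congmN d x y : congm d x y -> congm d (- x) (- y).
Proof. by move=> [u ->]; exists (- u); ring. Qed.
Lemma congmM d x y x' y' : congm d x y -> congm d x' y' -> congm d (x * x') (y * y').
Proof.
by move=> [u ->] [v ->]; exists (u * y' + y * v + d%:R * u * v); ring.
Qed.
Lemma congmX d n x y : congm d x y -> congm d (x ^+ n) (y ^+ n).
Proof.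
by move=> h; elim: n => [|n IH]; rewrite ?expr0 ?exprS; [exact: congm_refl|exact: congmM].
Qed.
Lemma congm_sum d n (F G : 'I_n -> B) : (forall i, congm d (F i) (G i)) ->
  congm d (\sum_i F i) (\sum_i G i).
Proof.
move=> h; elim/big_ind2: _ => //; first exact: congm_refl.
by move=> *; exact: congmD.
Qed.
Lemma congm_dvd d e x y : (d %| e)%N -> congm e x y -> congm d x y.
Proof. by move=> /dvdnP[q ->] [z ->]; exists (q%:R * z); rewrite natrM; ring. Qed.
Lemma congmMl d e x y : congm d x y -> congm (e * d) (e%:R * x) (e%:R * y).
Proof. by move=> [z ->]; exists z; rewrite natrM; ring. Qed.

Context (p : nat) (pr : prime p).

Lemma congmXp k x y : congm (p ^ k.+1) x y -> congm (p ^ k.+2) (x ^+ p) (y ^+ p).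
Proof.
move=> h; have [z e] := h.
have hp : congm p x y by apply: congm_dvd h; rewrite expnS dvdn_mulr.
have [w ew] : congm p (\sum_(i < p) x ^+ (p.-1 - i) * y ^+ i) 0.
  apply: (@congm_trans _ (\sum_(i < p) y ^+ (p.-1 - i) * y ^+ i)).
    by apply: congm_sum => i; apply: congmM; [exact: congmX|exact: congm_refl].
  exists (y ^+ p.-1); rewrite add0r mulr_natl.
  rewrite (eq_bigr (fun=> y ^+ p.-1)); last first.
    by move=> i _; rewrite -exprD; congr (_ ^+ _); have := ltn_ord i; lia.
  by rewrite sumr_const card_ord.
exists (z * w); apply/eqP; rewrite addrC -subr_eq subrXX ew add0r e.
by apply/eqP; rewrite (expnS p k.+1) natrM; ring.
Qed.

Lemma congmXpn k m x y :
  congm (p ^ k.+1) x y -> congm (p ^ (k + m).+1) (x ^+ (p ^ m)) (y ^+ (p ^ m)).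
Proof.
move=> h; elim: m => [|m IH]; first by rewrite addn0 expn0 !expr1.
by rewrite addnS (expnSr p m) !exprM; exact: congmXp.
Qed.

Lemma congm_freshman x y : congm p ((x + y) ^+ p) (x ^+ p + y ^+ p).
Proof.
case: p pr => [//|q] prq; rewrite exprDn big_ord_recl big_ord_recr /=.
rewrite subn0 !expr0 mulr1 bin0 mulr1n /bump /= add1n subnn expr0 mul1r binn mulr1n.
have [w ->] : congm q.+1 (\sum_(i < q) x ^+ (q.+1 - (1 + i)) * y ^+ (1 + i)
    *+ 'C(q.+1, 1 + i)) 0.
  apply: (@congm_trans _ (\sum_(i < q) 0)); last first.
    by rewrite big1 //; exact: congm_refl.
  apply: congm_sum => i.
  have /dvdnP[c ->] : (q.+1 %| 'C(q.+1, 1 + i))%N.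
    by apply: prime_dvd_bin => //; have := ltn_ord i; lia.
  exists ((x ^+ (q.+1 - (1 + i)) * y ^+ (1 + i)) *+ c).
  by rewrite add0r mulrnA mulr_natl.
by exists w; ring.
Qed.

Lemma congm_oppX y : congm p (- y ^+ p) ((- y) ^+ p).
Proof.
have := congm_freshman y (- y).
rewrite subrr expr0n (gtn_eqF (prime_gt0 pr)) => -[z e]; exists z.
have -> : - y ^+ p = - (y ^+ p + (- y) ^+ p + p%:R * z) + (- y) ^+ p + p%:R * z.
  by ring.
by rewrite -e oppr0 add0r.
Qed.
End Congruence.

(* The ghost component a_0^(p^n) + p a_1^(p^(n-1)) + ... + p^n a_n. *)
Definition ghost (p : nat) (A : comNzRingType) (a : nat -> A) (n : nat) : A :=
  \sum_(i < n.+1) (p ^ i)%:R * a i ^+ (p ^ (n - i)).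

Lemma ghost_recr (p : nat) (A : comNzRingType) (a : nat -> A) (n : nat) :
  ghost p a n =
  \sum_(i < n) (p ^ i)%:R * a i ^+ (p ^ (n - i)) + (p ^ n)%:R * a n.
Proof. by rewrite /ghost big_ord_recr /= subnn expn0 expr1. Qed.

Lemma ghost_inj_torsion_free (p : nat) (A : comNzRingType) (a b : nat -> A) :
  (forall n x y, (p ^ n)%:R * x = (p ^ n)%:R * y :> A -> x = y) ->
  ghost p a =1 ghost p b -> a =1 b.
Proof.
move=> tf e n; elim/ltn_ind: n => n IH; have := e n.
rewrite (ghost_recr p a n) (ghost_recr p b n).
rewrite (eq_bigr (fun i : 'I_n => (p ^ i)%:R * b i ^+ (p ^ (n - i)))); last first.
  by move=> i _; rewrite IH.
by move/addrI/tf.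
Qed.

Lemma ghost_morph (p : nat) (A B : comNzRingType) (g : {rmorphism A -> B}) a n :
  g (ghost p a n) = ghost p (g \o a) n.
Proof.
rewrite rmorph_sum; apply: eq_bigr => i _.
by rewrite rmorphM rmorph_nat rmorphXn.
Qed.

(* The sequence s of polynomials with ghost components g, defined recursively
   by s_n = (g_n - sum_(i < n) p^i s_i^(p^(n-i))) / p^n; see [ghost_unghost]. *)
Fixpoint unghost_seq (p : nat) (I : choiceType) (g : nat -> Zpoly I) (n : nat) :
    seq (Zpoly I) :=
  if n is m.+1 then
    let s := unghost_seq p g m in
    rcons s (Zpoly_div
      (g m - \sum_(i < m) (p ^ i)%:R * s`_i ^+ (p ^ (m - i))) (p ^ m))
  else [::].

HB.lock Definition unghost (p : nat) (I : choiceType) (g : nat -> Zpoly I) (n : nat) :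
    Zpoly I := (unghost_seq p g n.+1)`_n.

Section Unghost.
Context (p : nat) (I : choiceType).
Local Notation unghost_seq := (@unghost_seq p I).
Local Notation unghost := (@unghost p I).

Lemma size_unghost_seq g n : size (unghost_seq g n) = n.
Proof. by elim: n => //= n IH; rewrite size_rcons IH. Qed.

Lemma nth_unghost_seq g n i : (i < n)%N -> (unghost_seq g n)`_i = unghost g i.
Proof.
elim: n => // n IH; rewrite ltnS leq_eqVlt => /orP[/eqP->|lt_in]; first by rewrite unghost.unlock.
by rewrite /= nth_rcons size_unghost_seq lt_in IH.
Qed.

Lemma unghostE g n : unghost g n =
  Zpoly_div (g n - \sum_(i < n) (p ^ i)%:R * unghost g i ^+ (p ^ (n - i))) (p ^ n).
Proof.
have e : \sum_(i < n) (p ^ i)%:R * (unghost_seq g n)`_i ^+ (p ^ (n - i)) =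
         \sum_(i < n) (p ^ i)%:R * unghost g i ^+ (p ^ (n - i)).
  by apply: eq_bigr => i _; rewrite (nth_unghost_seq g (ltn_ord i)).
by rewrite -e unghost.unlock [unghost_seq g n.+1]/= nth_rcons size_unghost_seq ltnn eqxx.
Qed.

Context (pr : prime p).

Definition Zfrob : Zpoly I -> Zpoly I := @Zeval I (Zpoly I) (fun i => Zvar i ^+ p).
HB.instance Definition _ := GRing.RMorphism.on Zfrob.

Lemma Zfrob_congm P : congm p (Zfrob P) (P ^+ p).
Proof.
elim/Zpoly_ind: P => [|i|P Q hP hQ|P Q hP hQ].
- by rewrite rmorph1 expr1n; exact: congm_refl.
- by rewrite /Zfrob Zeval_var; exact: congm_refl.
- have hN := congm_oppX pr Q.
  rewrite rmorphB; apply: (@congm_trans _ _ (P ^+ p + (- Q) ^+ p)).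
    by apply: congmD hP _; apply: congm_trans hN; exact: congmN.
  by apply: congm_sym; exact: (congm_freshman pr).
- by rewrite rmorphM exprMn; exact: congmM hP hQ.
Qed.

Definition ghostly (g : nat -> Zpoly I) : Prop :=
  forall n, congm (p ^ n.+1) (g n.+1) (Zfrob (g n)).

Lemma Zfrob_ghost (a : nat -> Zpoly I) n :
  congm (p ^ n.+1) (Zfrob (ghost p a n))
    (\sum_(i < n.+1) (p ^ i)%:R * a i ^+ (p ^ (n.+1 - i))).
Proof.
rewrite ghost_morph; apply: congm_sum => i.
have le : (i <= n)%N by rewrite -ltnS.
have -> : (p ^ n.+1 = p ^ i * p ^ (0 + (n - i)).+1)%N.
  by rewrite -expnD; congr expn; lia.
have -> : a i ^+ (p ^ (n.+1 - i)) = (a i ^+ p) ^+ (p ^ (n - i)).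
  by rewrite subSn // expnS exprM.
apply: congmMl.
by apply: (@congmXpn _ p pr 0); rewrite expn1; exact: Zfrob_congm.
Qed.

Lemma ghostly_ghost (a : nat -> Zpoly I) : ghostly (ghost p a).
Proof.
move=> n; rewrite ghost_recr.
rewrite -[Zfrob _]addr0; apply: congmD; first exact/congm_sym/Zfrob_ghost.
by exists (a n.+1); rewrite add0r.
Qed.

Lemma ghost_unghost g : ghostly g -> ghost p (unghost g) =1 g.
Proof.
move=> hg; have gE n : (exists z, g n =
    \sum_(i < n) (p ^ i)%:R * unghost g i ^+ (p ^ (n - i)) + (p ^ n)%:R * z) ->
    ghost p (unghost g) n = g n.
  case=> z; set s := \sum_(i < n) _ => e.
  have e' : g n - s = (p ^ n)%:R * z by rewrite e addrC addKr.
  have pn0 : (0 < p ^ n)%N by rewrite expn_gt0 prime_gt0.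
  rewrite ghost_recr -/s (unghostE g n) -/s e'.
  by rewrite Zpoly_divK // -e.
elim=> [|n IH]; apply: gE.
  by exists (g 0); rewrite big_ord0 add0r expn0 mul1r.
apply: congm_trans (hg n) _; rewrite -IH; exact: Zfrob_ghost.
Qed.

Lemma ghost_inj (a b : nat -> Zpoly I) : ghost p a =1 ghost p b -> a =1 b.
Proof.
apply: ghost_inj_torsion_free => n x y; apply: Zpoly_natI.
by rewrite expn_gt0 prime_gt0.
Qed.

Lemma ghostlyD g h : ghostly g -> ghostly h -> ghostly (fun n => g n + h n).
Proof. by move=> hg hh n; rewrite rmorphD; exact: congmD (hg n) (hh n). Qed.
Lemma ghostlyM g h : ghostly g -> ghostly h -> ghostly (fun n => g n * h n).
Proof. by move=> hg hh n; rewrite rmorphM; exact: congmM (hg n) (hh n). Qed.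
Lemma ghostlyN g : ghostly g -> ghostly (fun n => - g n).
Proof. by move=> hg n; rewrite rmorphN; exact: congmN (hg n). Qed.

End Unghost.

(* The Witt polynomials, in the variables X_n = X_(false, n), Y_n = X_(true, n). *)
Section WittPolynomials.
Context (p : nat).

Let X (n : nat) : Zpoly (bool * nat)%type := Zvar (false, n).
Let Y (n : nat) : Zpoly (bool * nat)%type := Zvar (true, n).

Definition witt_sum := unghost p (fun n => ghost p X n + ghost p Y n).
Definition witt_prod := unghost p (fun n => ghost p X n * ghost p Y n).
Definition witt_opp := unghost p (fun n => - ghost p X n).

Definition witt_eval (A : comNzRingType) (Phi : nat -> Zpoly (bool * nat)%type)
    (a b : nat -> A) (n : nat) : A :=
  Zeval (fun i => if i.1 then b i.2 else a i.2) (Phi n).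

Lemma witt_eval_morph (A B : comNzRingType) (g : {rmorphism A -> B}) Phi a b :
  g \o witt_eval Phi a b =1 witt_eval Phi (g \o a) (g \o b).
Proof.
move=> n; rewrite /= Zeval_morph; apply: Zeval_ext => -[[] i] //.
Qed.

Context (pr : prime p) (A : comNzRingType).
Implicit Types a b : nat -> A.

Let ev a b : {rmorphism Zpoly (bool * nat)%type -> A} :=
  Zeval (fun i : bool * nat => if i.1 then b i.2 else a i.2).

Let evX a b n : ev a b (ghost p X n) = ghost p a n.
Proof.
rewrite ghost_morph; congr (ghost p _ n).
by apply/funext => k; rewrite /= Zeval_var.
Qed.
Let evY a b n : ev a b (ghost p Y n) = ghost p b n.
Proof.
rewrite ghost_morph; congr (ghost p _ n).
by apply/funext => k; rewrite /= Zeval_var.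
Qed.

Let ghost_ev a b Phi g n : ghostly p g -> Phi = unghost p g ->
  ghost p (witt_eval Phi a b) n = ev a b (g n).
Proof.
by move=> hg ->; rewrite -(ghost_unghost pr hg) ghost_morph.
Qed.

Lemma ghost_witt_sum a b n :
  ghost p (witt_eval witt_sum a b) n = ghost p a n + ghost p b n.
Proof.
rewrite (ghost_ev _ _ _ (ghostlyD (ghostly_ghost pr X) (ghostly_ghost pr Y)) erefl).
exact: etrans (rmorphD _ _ _) (f_equal2 +%R (evX a b n) (evY a b n)).
Qed.

Lemma ghost_witt_prod a b n :
  ghost p (witt_eval witt_prod a b) n = ghost p a n * ghost p b n.
Proof.
rewrite (ghost_ev _ _ _ (ghostlyM (ghostly_ghost pr X) (ghostly_ghost pr Y)) erefl).
exact: etrans (rmorphM _ _ _) (f_equal2 *%R (evX a b n) (evY a b n)).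
Qed.

Lemma ghost_witt_opp a b n :
  ghost p (witt_eval witt_opp a b) n = - ghost p a n.
Proof.
rewrite (ghost_ev _ _ _ (ghostlyN (ghostly_ghost pr X)) erefl).
exact: etrans (rmorphN _ _) (congr1 _ (evX a b n)).
Qed.

End WittPolynomials.

(* p-typical Witt vectors, given by their Witt components. The ring operations
   below evaluate the universal integral polynomials determined by the
   requirement that the ghost components be ring morphisms. *)
Record witt (p : nat) (pr : prime p) (A : Type) := Witt { wcoef : nat -> A }.

HB.instance Definition _ (p : nat) (pr : prime p) (A : Type) :=
  gen_eqMixin (witt pr A).
HB.instance Definition _ (p : nat) (pr : prime p) (A : Type) :=
  gen_choiceMixin (witt pr A).

HB.lock Definition witt_add (p : nat) (pr : prime p) (A : comNzRingType)
    (a b : witt pr A) : witt pr A :=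
  Witt pr (witt_eval (witt_sum p) (wcoef a) (wcoef b)).

HB.lock Definition witt_mul (p : nat) (pr : prime p) (A : comNzRingType)
    (a b : witt pr A) : witt pr A :=
  Witt pr (witt_eval (witt_prod p) (wcoef a) (wcoef b)).

(* The polynomials [witt_opp p] do not involve the second set of variables. *)
HB.lock Definition witt_neg (p : nat) (pr : prime p) (A : comNzRingType)
    (a : witt pr A) : witt pr A :=
  Witt pr (witt_eval (witt_opp p) (wcoef a) (wcoef a)).

Section WittRing.
Context (p : nat) (pr : prime p).

Section Ops.
Context (A : comNzRingType).
Implicit Types a b : witt pr A.

Lemma wittP a b : wcoef a =1 wcoef b -> a = b.
Proof. by case: a b => [a] [b] /= /funext ->. Qed.

Definition witt_zero : witt pr A := Witt pr (fun=> 0).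
Definition witt_one : witt pr A := Witt pr (fun n => (n == 0)%:R).

Definition wghost a n := ghost p (wcoef a) n.

Lemma wghostD a b n : wghost (witt_add a b) n = wghost a n + wghost b n.
Proof. by rewrite /wghost witt_add.unlock; exact: ghost_witt_sum. Qed.
Lemma wghostM a b n : wghost (witt_mul a b) n = wghost a n * wghost b n.
Proof. by rewrite /wghost witt_mul.unlock; exact: ghost_witt_prod. Qed.
Lemma wghostN a n : wghost (witt_neg a) n = - wghost a n.
Proof. by rewrite /wghost witt_neg.unlock; exact: ghost_witt_opp. Qed.
Lemma wghost0 n : wghost witt_zero n = 0.
Proof.
rewrite /wghost /ghost big1 // => i _.
by rewrite expr0n gtn_eqF ?mulr0 // expn_gt0 prime_gt0.
Qed.
Lemma wghost1 n : wghost witt_one n = 1.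
Proof.
rewrite /wghost /ghost big_ord_recl big1 ?addr0 => [|i _] /=; first by rewrite mul1r expr1n.
by rewrite expr0n gtn_eqF ?mulr0 // expn_gt0 prime_gt0.
Qed.
End Ops.

Definition witt_map (A B : Type) (g : A -> B) (a : witt pr A) : witt pr B :=
  Witt pr (g \o wcoef a).

Section Map.
Context (A B : comNzRingType) (g : {rmorphism A -> B}).
Lemma witt_map_add a b : witt_map g (witt_add a b) = witt_add (witt_map g a) (witt_map g b).
Proof.
by apply: wittP => n; rewrite witt_add.unlock; exact: witt_eval_morph.
Qed.
Lemma witt_map_mul a b : witt_map g (witt_mul a b) = witt_mul (witt_map g a) (witt_map g b).
Proof.
by apply: wittP => n; rewrite witt_mul.unlock; exact: witt_eval_morph.
Qed.
Lemma witt_map_neg a : witt_map g (witt_neg a) = witt_neg (witt_map g a).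
Proof.
by apply: wittP => n; rewrite witt_neg.unlock; exact: witt_eval_morph.
Qed.
Lemma witt_map_zero : witt_map g (witt_zero A) = witt_zero B.
Proof. by apply: wittP => n; rewrite /= rmorph0. Qed.
Lemma witt_map_one : witt_map g (witt_one A) = witt_one B.
Proof. by apply: wittP => n; rewrite /= rmorph_nat. Qed.
End Map.

(* Any three Witt vectors are the images of generic ones over a polynomial
   ring, where Witt vectors are determined by their ghost components. *)
Lemma witt_generic (A : comNzRingType) (a b c : witt pr A) :
  exists (g : {rmorphism Zpoly (nat * nat)%type -> A}) a' b' c',
  [/\ a = witt_map g a', b = witt_map g b' & c = witt_map g c'].
Proof.
pose v (i : nat * nat) :=
  if i.1 is k.+1 then (if k is 0 then wcoef b i.2 else wcoef c i.2) else wcoef a i.2.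
exists (Zeval v), (Witt pr (fun n => Zvar (0%N, n))),
  (Witt pr (fun n => Zvar (1%N, n))), (Witt pr (fun n => Zvar (2%N, n))).
by split; apply: wittP => n; rewrite /= Zeval_var.
Qed.

Lemma wghost_inj (I : choiceType) (a b : witt pr (Zpoly I)) :
  wghost a =1 wghost b -> a = b.
Proof. by move=> /(ghost_inj pr) /wittP. Qed.

Definition wghostE := (wghostD, wghostM, wghostN, wghost0, wghost1).

Section Ring.
Context (A : comNzRingType).

Let wadd := @witt_add p pr A.
Let wmul := @witt_mul p pr A.
Let waddA : associative wadd.
Proof.
move=> a b c; have [g [a' [b' [c' [-> -> ->]]]]] := witt_generic a b c.
rewrite /wadd -!witt_map_add; congr witt_map.
apply: wghost_inj => n; rewrite !wghostE; exact: addrA.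
Qed.
Let waddC : commutative wadd.
Proof.
move=> a b; have [g [a' [b' [_ [-> -> _]]]]] := witt_generic a b b.
rewrite /wadd -!witt_map_add; congr witt_map.
apply: wghost_inj => n; rewrite !wghostE; exact: addrC.
Qed.
Let wadd0 : left_id (witt_zero A) wadd.
Proof.
move=> a; have [g [a' [_ [_ [-> _ _]]]]] := witt_generic a a a.
rewrite /wadd -(witt_map_zero g) -?witt_map_neg -!witt_map_add; congr witt_map.
apply: wghost_inj => n; rewrite !wghostE; exact: add0r.
Qed.
Let waddN : left_inverse (witt_zero A) (@witt_neg p pr A) wadd.
Proof.
move=> a; have [g [a' [_ [_ [-> _ _]]]]] := witt_generic a a a.
rewrite /wadd -(witt_map_zero g) -?witt_map_neg -!witt_map_add; congr witt_map.
apply: wghost_inj => n; rewrite !wghostE; exact: addNr.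
Qed.
HB.instance Definition _ := GRing.isZmodule.Build (witt pr A) waddA waddC wadd0 waddN.

Let wmulA : associative wmul.
Proof.
move=> a b c; have [g [a' [b' [c' [-> -> ->]]]]] := witt_generic a b c.
rewrite /wmul -!witt_map_mul; congr witt_map.
apply: wghost_inj => n; rewrite !wghostE; exact: mulrA.
Qed.
Let wmulC : commutative wmul.
Proof.
move=> a b; have [g [a' [b' [_ [-> -> _]]]]] := witt_generic a b b.
rewrite /wmul -!witt_map_mul; congr witt_map.
apply: wghost_inj => n; rewrite !wghostE; exact: mulrC.
Qed.
Let wmul1 : left_id (witt_one A) wmul.
Proof.
move=> a; have [g [a' [_ [_ [-> _ _]]]]] := witt_generic a a a.
rewrite /wmul -(witt_map_one g) -!witt_map_mul; congr witt_map.
apply: wghost_inj => n; rewrite !wghostE; exact: mul1r.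
Qed.
Let wmulD : left_distributive wmul wadd.
Proof.
move=> a b c; have [g [a' [b' [c' [-> -> ->]]]]] := witt_generic a b c.
rewrite /wmul /wadd -!(witt_map_add, witt_map_mul); congr witt_map.
apply: wghost_inj => n; rewrite !wghostE; exact: mulrDl.
Qed.
Let wone_neq0 : witt_one A != 0 :> witt pr A.
Proof.
apply/eqP => /(congr1 (fun a => wcoef a 0)) /eqP.
by rewrite /= oner_eq0.
Qed.
HB.instance Definition _ := GRing.Zmodule_isComNzRing.Build (witt pr A)
  wmulA wmulC wmul1 wmulD wone_neq0.

Lemma wcoefD (a b : witt pr A) :
  wcoef (a + b) = witt_eval (witt_sum p) (wcoef a) (wcoef b).
Proof. by rewrite -[a + b]/(witt_add a b) witt_add.unlock. Qed.
Lemma wcoefM (a b : witt pr A) :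
  wcoef (a * b) = witt_eval (witt_prod p) (wcoef a) (wcoef b).
Proof. by rewrite -[a * b]/(witt_mul a b) witt_mul.unlock. Qed.
End Ring.
End WittRing.

(* Main.v *)
Require Import Defs.
From HB Require Import structures.
From mathcomp Require Import all_boot all_order all_algebra.
From mathcomp Require Import zify ring lra.
From mathcomp Require Import boolp classical_sets.

Set Implicit Arguments.
Unset Strict Implicit.
Unset Printing Implicit Defensive.

Import Order.TTheory GRing.Theory Num.Theory.

Local Open Scope classical_set_scope.
Local Open Scope ring_scope.

(** Write A for the perfect closure of R, phi : R -> A for the canonical map
    (its kernel is the nilradical, and every element of A has a p-power in
    phi(R)) and W for W(A). In dimension one there is an x in the maximal ideal
    such that xi = phi(x) is a nonzerodivisor and the maximal ideal is the only
    prime containing x ([exists_parameter]); xi has fractional powers xi^e in A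
    for every e >= 0 in Z[1/p] ([xpow]).

    Let tau_n = p^-(3^n), c_n = tau_0 + ... + tau_(n-1), and let c be the limit
    of the c_n, a number whose base p digits are extremely sparse. Put
    g = sum_m p^m [xi^(1 - c_m)] in W. If W were coherent, the colon ideal
    J = ([xi] : g) would be finitely generated, and so would be its image J0 in
    A = W/pW. Now J0 is squeezed around the cut c: it contains xi^e for every
    e > c ([sparse_witt_upper]), and it is contained in xi^(c_n + epsilon_n) A
    for every n, for some epsilon_n > 0 ([sparse_witt_colon]). Over a valuation
    ring the second inclusion would follow from the multiplicativity of the
    Gauss norm. Here it comes from dividing g by [xi^(1 - E)], for some E
    slightly larger than c, and splitting the quotient as s + p^(n+1) G', where
    s is divisible by a power of [xi] with exponent about tau_n, and the leading
    term of G' has an exponent of about tau_(n+1) = tau_n^3 only. For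
    K = 1 / tau_n the power s^K vanishes modulo [xi^E], and p is a
    nonzerodivisor modulo [xi^E]; so G'^K h is divisible by [xi^E] for every h
    in J, and the factor G'^K costs an exponent of about tau_n^2 only.

    Suppose that J0 is generated by y_1, ..., y_k. For q = p^(3^n) with n large,
    q c_(n+1) is an integer M, the y_i^q lie in phi(R), and z_i = y_i^q / xi^M
    are elements of A lying in phi(R)[1/xi], some power of which is in xi A.
    On the other hand xi^(2 tau_n^2) is in the ideal generated by the z_i.
    The noetherian hypothesis enters through an argument in the style of
    Krull and Akizuki ([root_bound]): there is an N depending only on R and x
    such that z_i^N is in xi A for all such z_i. Applying the N-th power of
    Frobenius, one finds that xi^(2 p^N tau_n^2) is in xi A, although the
    exponent is less than 1; so xi is a unit, which is absurd. *)

(** * Ideals of a noetherian local ring *)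

Section Ideals.
Context (R : comNzRingType).
Implicit Types (I J P Q m : set R) (a b r s t u v : R).

Definition ideal I := I 0 /\ forall a u v, I u -> I v -> I (a * u + v).

Lemma ideal_mul I r u : ideal I -> I u -> I (r * u).
Proof. by case=> I0 IL Iu; rewrite -[_ * _]addr0; exact: IL. Qed.

Lemma ideal_add I u v : ideal I -> I u -> I v -> I (u + v).
Proof. by case=> I0 IL Iu Iv; rewrite -[u]mul1r; exact: IL. Qed.

Lemma ideal_closedP I : idealr_closed [in I] <-> ideal I /\ ~ I 1.
Proof.
split=> [[]|[[I0 IL] I1]].
  rewrite !in_setE => I0 I1 IL; split; last by move=> /mem_set h; rewrite h in I1.
  split=> // a u v /mem_set hu /mem_set hv.
  by have := IL a u v hu hv; rewrite in_setE.
split; rewrite ?in_setE //; first by apply/negP; rewrite in_setE.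
by move=> a u v /set_mem hu /set_mem hv; apply/mem_set; exact: IL.
Qed.

Lemma prime_idealP P : prime_ideal P <->
  [/\ ideal P, ~ P 1 & forall u v, P (u * v) -> P u \/ P v].
Proof.
split=> [[/ideal_closedP[idP P1] hP]|[idP P1 hP]].
  split=> // u v /mem_set h.
  by case/orP: (hP u v h); rewrite in_setE; [left | right].
split; first exact/ideal_closedP.
by move=> u v /set_mem /hP[] h; apply/orP; [left | right]; apply/mem_set.
Qed.

Lemma ideal_extend I a : ideal I -> ideal [set u | exists i r, I i /\ u = i + r * a].
Proof.
move=> [I0 IL]; split; first by exists 0, 0; rewrite mul0r addr0.
move=> b _ _ [i [r [Ii ->]]] [j [s [Ij ->]]].
by exists (b * i + j), (b * r + s); split; [exact: IL | ring].
Qed.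

Lemma ideal_colon I a : ideal I -> ideal [set u | I (u * a)].
Proof.
move=> [I0 IL]; split=> [|b u v /= Iu Iv]; first by rewrite /= mul0r.
by have := IL b _ _ Iu Iv; congr I; ring.
Qed.

Lemma ideal_set1 : ideal [set 0].
Proof. by split=> // a _ _ -> ->; rewrite mulr0 addr0. Qed.

Section Noetherian.
Hypothesis noethR : noetherian R.

Lemma noetherian_max (F : set (set R)) : (forall I, F I -> ideal I) ->
  (exists I, F I) -> exists2 I, F I & forall J, F J -> I `<=` J -> J `<=` I.
Proof.
move=> Fid [I0 FI0]; apply: contrapT => nomax.
have next (I : {I | F I}) : exists J : {I | F I},
    sval I `<=` sval J /\ ~ sval J `<=` sval I.
  case: I => I FI; apply: contrapT => h; apply: nomax; exists I => // J FJ IJ.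
  by apply: contrapT => JI; apply: h; exists (exist _ J FJ).
have [g hg] := choice next.
(* Otherwise some chain c_0, c_1, ... increases strictly. *)
pose c n : set R := sval (iter n g (exist _ I0 FI0)).
have cid n : ideal (c n) by apply: Fid; exact: (proj2_sig (iter n g _)).
have cS n : c n `<=` c n.+1 /\ ~ c n.+1 `<=` c n by exact: hg.
have cle n k : c n `<=` c (n + k)%N.
  by elim: k => [|k IH]; rewrite ?addn0 // addnS => x /IH; exact: (cS _).1.
pose U : set R := [set x | exists n, c n x].
have [|n [s eU]] := noethR (I := U : set R^o).
  split=> [|a u v]; first by apply/mem_set; exists 0; exact: (cid 0).1.
  move=> /set_mem[i ui] /set_mem[j vj]; apply/mem_set; exists (i + j)%N.
  by apply: (cid _).2; [exact: cle | rewrite addnC; exact: cle].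
have sU i : exists n, c n (s i).
  have : U (s i).
    rewrite eU; exists (delta_mx 0 i) => //; rewrite /lincomb (bigD1 i) //= big1.
      by rewrite addr0 mxE !eqxx /= scale1r.
    by move=> j ji; rewrite mxE eqxx (negbTE ji) /= scale0r.
  by [].
have [d hd] := choice sU.
pose D := (\max_i d i)%N.
have sD i : c D (s i).
  by have := cle (d i) (D - d i)%N _ (hd i); rewrite subnKC //; exact: leq_bigmax.
apply: (cS D).2 => x xD.
have : U x by exists D.+1.
rewrite eU => -[k _ <-]; rewrite /lincomb.
apply: (big_ind (c D)); first exact: (cid D).1.
  by move=> u v; exact: ideal_add (cid D).
by move=> i _; exact: ideal_mul (cid D) (sD i).
Qed.

(** An ideal maximal among those disjoint from S is prime. *)
Lemma prime_avoiding (S : set R) : S 1 -> (forall u v, S u -> S v -> S (u * v)) ->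
  ~ S 0 -> exists2 Q, prime_ideal Q & forall u, Q u -> ~ S u.
Proof.
move=> S1 SM S0.
have [||Q [idQ QS] maxQ] := @noetherian_max [set I | ideal I /\ forall u, I u -> ~ S u].
- by move=> I [].
- by exists [set 0]; split; [exact: ideal_set1 | move=> u ->].
exists Q => //; apply/prime_idealP; split=> // [Q1|u v Quv]; first exact: QS S1.
have hit w : ~ Q w -> exists i r, Q i /\ S (i + r * w).
  move=> Qw; apply: contrapT => h; apply: Qw.
  apply: (maxQ [set z | exists i r, Q i /\ z = i + r * w]).
  - split; first exact: ideal_extend.
    by move=> _ [i [r [Qi ->]]] Sz; apply: h; exists i, r.
  - by move=> i Qi; exists i, 0; rewrite mul0r addr0.
  by exists 0, 1; split; [exact: idQ.1 | rewrite mul1r add0r].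
apply: contrapT => /not_orP[/hit[i [r [Qi Si]]] /hit[j [s [Qj Sj]]]].
apply: (QS _ _ (SM _ _ Si Sj)).
have -> : (i + r * u) * (j + s * v) =
    (j + s * v) * i + ((r * u) * j + ((r * s) * (u * v) + 0)) by ring.
by do 3! apply: idQ.2 => //; exact: idQ.1.
Qed.

Lemma local_max : local_ring R -> exists m, [/\ ideal m, ~ m 1 &
  forall I, ideal I -> ~ I 1 -> I `<=` m].
Proof.
move=> [m [[/ideal_closedP[idm m1] _] uniqm]]; exists m; split=> // I idI I1.
have [||M [idM M1 IM] maxM] :=
    @noetherian_max [set J | [/\ ideal J, ~ J 1 & I `<=` J]].
- by move=> J [idJ _ _].
- by exists I; split.
have <- // : M = m.
symmetry; apply: uniqm; split=> [|J /ideal_closedP[idJ J1] MJ]; first exact/ideal_closedP.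
by apply/seteqP; split=> //; apply: maxM => //; split=> //; exact: subset_trans MJ.
Qed.

End Noetherian.
End Ideals.

(** * A parameter of a one-dimensional local ring *)

Section DimensionOne.
Context (R A : comNzRingType) (phi : {rmorphism R -> A}).
Hypothesis noethR : noetherian R.
Hypothesis locR : local_ring R.
Hypothesis dimR : krull_dim_eq R 1.
Hypothesis phi_nil : forall r, phi r = 0 -> exists n, r ^+ n = 0.
Hypothesis redA : forall a : A, a * a = 0 -> a = 0.

Lemma prime_exp (P : set R) r n : prime_ideal P -> P (r ^+ n) -> P r.
Proof.
move=> /prime_idealP[_ P1 PM]; elim: n => [|n IH]; rewrite ?expr0 //.
by rewrite exprS => /PM[|/IH].
Qed.

(** The kernel of phi consists of nilpotents, so it lies in every prime. *)
Lemma prime_ker (P : set R) r : prime_ideal P -> phi r = 0 -> P r.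
Proof.
move=> pP /phi_nil[n rn]; apply: (@prime_exp P r n pP); rewrite rn.
by have /prime_idealP[[]] := pP.
Qed.

Lemma dim1_no_chain2 (P Q S : set R) : prime_ideal P -> prime_ideal Q -> prime_ideal S ->
  P `<` Q -> Q `<` S -> False.
Proof.
move=> pP pQ pS PQ QS.
suff : prime_chain 2 (fun i => nth S [:: P; Q] i) by move=> /dimR.2.
by split=> [[|[|[|]]]|[|[|]]].
Qed.

(** The nonzerodivisor modulo nilpotents comes from maximality of its double
    annihilator; the annihilator of m vanishes because m is not a minimal
    prime. A prime P containing x but different from m would strictly contain
    a prime avoiding all x^i s with s outside P, making a chain of length 2. *)
Lemma exists_parameter : exists (m : set R) (x : R),
  [/\ ideal m, ~ m 1 & forall r, ~ m r -> exists s, r * s = 1] /\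
  [/\ m x, forall z, phi (z * x) = 0 -> phi z = 0
    & forall P, prime_ideal P -> P x -> m `<=` P].
Proof.
have [m [idm m1 maxm]] := local_max noethR locR.
have unitm r : ~ m r -> exists s, r * s = 1.
  move=> mr; apply: contrapT => h; apply: mr.
  apply: (maxm [set u | exists s, u = r * s]); last by exists 1; rewrite mulr1.
    split=> [|a _ _ [s ->] [t ->]]; first by exists 0; rewrite mulr0.
    by exists (a * s + t); ring.
  by case=> s e; apply: h; exists s.
have primem P : prime_ideal P -> P `<=` m.
  by move=> /prime_idealP[idP P1 _]; exact: maxm.
have pm : prime_ideal m.
  apply/prime_idealP; split=> // u v muv; apply: contrapT.
  move=> /not_orP[/unitm[s us] /unitm[t vt]]; apply: m1.
  have -> : 1 = (s * t) * (u * v) by rewrite -[LHS]mulr1 -{1}us -vt; ring.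
  exact: ideal_mul.
have [[P0 P1] [pP0 pP1 P01]] : exists P : set R * set R,
    [/\ prime_ideal P.1, prime_ideal P.2 & P.1 `<` P.2].
  have [P [hP hlt]] := dimR.1.
  by exists (P 0%N, P 1%N); split; [exact: hP | exact: hP | exact: (hlt 0%N)].
(* No nonzero element of the image of R is killed by m. *)
have ann_m z : phi z != 0 -> exists2 t, m t & phi (z * t) != 0.
  move=> /eqP z0; apply: contrapT => h.
  have zm t : m t -> phi (z * t) = 0.
    by move=> mt; apply: contrapT => /eqP ht; apply: h; exists t.
  have [_ /existsNP[t /not_implyP[P1t P0t]]] := P01.
  have /prime_idealP[_ _ PM] := pP0.
  have : P0 (z * t) by apply: prime_ker => //; apply/zm/(primem P1).
  case/PM => // /(primem _ pP0) mz.
  by apply: z0; apply: redA; rewrite -rmorphM zm.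
pose ann (S : set R) : set R := [set w | forall s, S s -> phi (w * s) = 0].
have id_ann S : ideal (ann S).
  split=> [s _|a u v hu hv s Ss]; first by rewrite mul0r rmorph0.
  have -> : (a * u + v) * s = a * (u * s) + v * s by ring.
  by rewrite rmorphD rmorphM hu // hv // mulr0 addr0.
(* Choose x in m with largest double annihilator. If z killed x and z t <> 0
   with t in m, then x + z t would have a strictly larger one. *)
have [||_ [x mx ->] maxx] := @noetherian_max R noethR
   [set I | exists2 x, m x & I = ann (ann [set x])].
- by move=> _ [x _ ->]; exact: id_ann.
- by exists (ann (ann [set 0])); exists 0 => //; exact: idm.1.
have regx z : phi (z * x) = 0 -> phi z = 0.
  move=> zx; apply: contrapT => /eqP /ann_m[t mt /eqP zt]; apply: zt.
  pose x' := x + z * t.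
  have mx' : m x' by apply: ideal_add => //; exact: ideal_mul.
  have annx w : phi (w * x') = 0 -> phi (w * x) = 0.
    move=> wx'; apply: redA; rewrite -rmorphM.
    have -> : w * x * (w * x) = w * x * (w * x') - w * w * t * (z * x).
      by rewrite /x'; ring.
    by rewrite rmorphB !(rmorphM _ _ (_ * _)) wx' zx !mulr0 subr0.
  have sub : ann (ann [set x]) `<=` ann (ann [set x']).
    by move=> a ha w hw; apply: ha => _ ->; apply: annx; exact: hw.
  have : ann (ann [set x']) x' by move=> w hw; rewrite mulrC; exact: hw.
  move=> /(maxx _ (ex_intro2 _ _ _ mx' erefl) sub) hx'.
  have zx' : phi (x' * z) = 0 by apply: hx' => _ ->.
  apply: redA; rewrite -rmorphM.
  have -> : z * t * (z * t) = t * (x' * z) - t * (z * x) by rewrite /x'; ring.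
  by rewrite rmorphB !rmorphM -rmorphM zx' -rmorphM zx !mulr0 subr0.
exists m, x; split; split=> // P pP Px; apply: contrapT => mP.
have Pm : P `<` m by split => //; exact: primem.
have /prime_idealP[idP PP1 PM] := pP.
have [|u v [i [s [Ps ->]]] [j [t [Pt ->]]]||Q pQ QS] :=
   @prime_avoiding R noethR [set u | exists i s, ~ P s /\ u = x ^+ i * s].
- by exists 0%N, 1; rewrite expr0 mulr1.
- exists (i + j)%N, (s * t); split; last by rewrite exprD; ring.
  by move=> /PM[].
- move=> [i [s [Ps /esym /(congr1 phi)]]]; rewrite rmorph0 => e; apply: Ps.
  apply: prime_ker => //; elim: i e => [|i IH]; rewrite ?expr0 ?mul1r //.
  by rewrite exprS -mulrA mulrC => /regx.
apply: (dim1_no_chain2 pQ pP pm _ Pm); split.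
  move=> u Qu; apply: contrapT => Pu; apply: (QS u Qu).
  by exists 0%N, u; rewrite expr0 mul1r.
by move=> /(_ x Px) /QS; apply; exists 1%N, 1; rewrite expr1 mulr1.
Qed.
End DimensionOne.

(** * Lengths *)

Section CompositionSeries.
Context (R : comNzRingType).
Hypothesis noethR : noetherian R.

(** Successive quotients J i / J i.+1 are generated by any nonzero element, so
    they are zero or simple. *)
Definition simple_series (J : nat -> set R) : Prop :=
  (forall i, ideal (J i)) /\
  forall i a b, J i a -> ~ J i.+1 a -> J i b -> exists r, J i.+1 (b - r * a).

(** The standard prime filtration, built from X upwards by noetherian
    induction: a maximal colon ideal (K : a) is a prime containing x, hence m,
    so that (K + R a) / K is simple. *)
Lemma composition_series (m : set R) (x : R) (X : set R) :
  ideal m -> (forall r, ~ m r -> exists s, r * s = 1) ->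
  (forall P, prime_ideal P -> P x -> m `<=` P) -> ideal X -> X x ->
  exists N J, [/\ J 0%N = setT, forall i, (N <= i)%N -> J i = X & simple_series J].
Proof.
move=> idm unitm primex idX Xx; apply: contrapT => badX.
pose good K := exists N J,
  [/\ J 0%N = setT, forall i, (N <= i)%N -> J i = K & simple_series J].
have [||K [idK XK badK] maxK] :=
    @noetherian_max R noethR [set K | [/\ ideal K, X `<=` K & ~ good K]].
- by move=> K [idK _ _].
- by exists X; split.
have K1 : ~ K 1.
  move=> K1; apply: badK; exists 0%N, (fun=> setT); split=> //.
    move=> i _; apply/seteqP; split=> // u _.
    by rewrite -[u]mulr1; exact: ideal_mul.
have [||_ [a Ka ->] maxa] :=
    @noetherian_max R noethR [set I | exists2 a, ~ K a & I = [set u | K (u * a)]].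
- by move=> _ [a _ ->]; exact: ideal_colon.
- by exists [set u | K (u * 1)]; exists 1.
have ma : m `<=` [set u | K (u * a)].
  apply: primex; last by rewrite /= mulrC; apply: ideal_mul => //; exact: XK.
  apply/prime_idealP; split; first exact: ideal_colon.
    by rewrite /= mul1r.
  move=> u v /= Kuva; case: (pselect (K (u * a))) => [|Kua]; [by left | right].
  apply: (maxa [set w | K (w * (u * a))]).
  - by exists (u * a).
  - by move=> w /= Kwa; rewrite mulrCA; exact: ideal_mul.
  by rewrite /= mulrA (mulrC v).
(* K' / K is simple, so a series ending at K' extends to K. *)
pose K' := [set u | exists i r, K i /\ u = i + r * a].
have KK' : K `<=` K' by move=> i Ki; exists i, 0; rewrite mul0r addr0.
have [N [J [J0 JN [idJ simJ]]]] : good K'.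
  apply: contrapT => bad; apply: Ka; apply: (maxK K' _ KK').
    split=> //; first exact: ideal_extend.
    exact: subset_trans KK'.
  by exists 0, 1; rewrite add0r mul1r; split=> //; exact: idK.1.
apply: badK; exists N.+1, (fun i => if (i <= N)%N then J i else K); split=> //.
  by move=> i; rewrite ltnNge => /negbTE->.
split=> [i|i b c]; first by case: ifP.
case: (ltngtP i N) => // [iN|->]; first exact: simJ.
rewrite JN // => -[j [r [Kj ->]]] Kr [k [s [Kk ->]]].
have mr : ~ m r by move=> /ma Kra; apply: Kr; exact: ideal_add.
have [t rt] := unitm r mr; exists (s * t).
have -> : k + s * a - s * t * (j + r * a) = - (s * t) * j + k + (s * (1 - r * t)) * a by ring.
by rewrite rt subrr mulr0 mul0r addr0; exact: idK.2.
Qed.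
End CompositionSeries.

Section LengthBound.
Context (R A : comNzRingType) (phi : {rmorphism R -> A}).
Implicit Types (P Q : set A).

Definition submodule P := P 0 /\ forall r u v, P u -> P v -> P (phi r * u + v).

Lemma submodule_scale P r u : submodule P -> P u -> P (phi r * u).
Proof. by case=> P0 PL Pu; rewrite -[_ * _]addr0; exact: PL. Qed.

Lemma submodule_add P u v : submodule P -> P u -> P v -> P (u + v).
Proof. by case=> P0 PL Pu Pv; rewrite -[u]mul1r -(rmorph1 phi); exact: PL. Qed.

Section Chain.
Variables (n : nat) (G : nat -> set A).
Hypothesis simG : forall i a b, (i < n)%N -> G i a -> ~ G i.+1 a -> G i b ->
  exists r, G i.+1 (b - phi r * a).

Let jumps P : {set 'I_n} := [set i : 'I_n | `[< exists a, [/\ P a, G i a & ~ G i.+1 a] >]]%SET.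

Let jumps_lt P Q : submodule P -> submodule Q -> P `<=` Q -> ~ Q `<=` P ->
  G n `<=` P -> Q `<=` G 0%N -> (#|jumps P| < #|jumps Q|)%N.
Proof.
move=> modP modQ PQ QP nP Q0; apply: proper_card.
have sPQ : jumps P \subset jumps Q.
  apply/fintype.subsetP => i; rewrite !inE => -[a [Pa Ga Ga']].
  by exists a; split=> //; exact: PQ.
rewrite properE sPQ; apply/negP => sQP; apply: QP => q Qq.
have {}Q0 := Q0 _ Qq.
(* Descending induction on i, from the common bottom term G n. *)
suff H k i q' : (i + k = n)%N -> Q q' -> G i q' -> P q' by exact: (H n 0%N).
elim: k i q' => [|k IH] i q' e {}Qq Gq; first by apply: nP; rewrite -e addn0.
have [/(IH i.+1 q')|Gq'] := pselect (G i.+1 q'); first by apply => //; lia.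
have lt_in : (i < n)%N by lia.
have /(fintype.subsetP sQP _) : Ordinal lt_in \in jumps Q.
  by rewrite inE; apply/asboolP; exists q'; split.
rewrite inE => /asboolP[a [Pa Ga Ga']].
have [r Gr] := simG lt_in Ga Ga' Gq.
rewrite -(subrK (phi r * a) q'); apply: submodule_add => //; last exact: submodule_scale.
apply: (IH i.+1) => //; first by lia.
rewrite addrC -mulNr -rmorphN; apply: modQ.2 => //; exact: PQ.
Qed.

(** Half of the Jordan-Hoelder theorem. Along the reference series G, a
    submodule P has a set of jumps, the i such that P meets G i outside
    G i.+1; this set grows strictly with P. *)
Lemma length_bound (Q : nat -> set A) t : (forall s, submodule (Q s)) ->
  (forall s, (s < t)%N -> Q s.+1 `<=` Q s /\ ~ Q s `<=` Q s.+1) ->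
  Q 0%N `<=` G 0%N -> G n `<=` Q t -> (t <= n)%N.
Proof.
move=> modQ ltQ Q0 nQ.
have leQ k s : (s + k <= t)%N -> Q (s + k)%N `<=` Q s.
  elim: k => [|k IH] h; first by rewrite addn0.
  by rewrite addnS => a /(ltQ (s + k)%N _).1 h'; apply: IH; [lia | apply: h'; lia].
have leQ0 s : (s <= t)%N -> Q s `<=` G 0%N.
  by move=> h a Qa; apply: Q0; apply: (leQ s 0%N).
have nQs s : (s <= t)%N -> G n `<=` Q s.
  by move=> h a /nQ; rewrite -(subnKC h); apply: leQ; lia.
suff H s : (s <= t)%N -> (s + #|jumps (Q s)| <= n)%N.
  by have := H t (leqnn _); lia.
elim: s => [|s IH] h; first by rewrite (leq_trans (max_card _)) // card_ord.
have := IH (ltnW h); have [h1 h2] := ltQ s h.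
have := jumps_lt (modQ _) (modQ _) h1 h2 (nQs _ h) (leQ0 _ (ltnW h)); lia.
Qed.
End Chain.
End LengthBound.

(** * Elements integral over the image of R, modulo the parameter *)

Section RootBound.
Context (R A : comNzRingType) (phi : {rmorphism R -> A}) (x : R).
Local Notation xi := (phi x).
Hypothesis regx : forall a, xi * a = 0 -> a = 0.
Local Notation submodule := (submodule phi).

Lemma xiI a b : xi * a = xi * b -> a = b.
Proof. by move=> e; apply: subr0_eq; apply: regx; rewrite mulrBr e subrr. Qed.

Lemma xiXI k a b : xi ^+ k * a = xi ^+ k * b -> a = b.
Proof.
by elim: k => [|k IH]; rewrite ?expr0 ?mul1r // exprS -!mulrA => /xiI.
Qed.

Section Powers.
Variables (z : A) (k n : nat) (u v : R).
Hypotheses (n0 : (0 < n)%N) (zu : xi ^+ k * z = phi u) (zv : z ^+ n = xi * phi v).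

(** The R-submodule of A generated by all xi z^i and by the z^i with i >= s. *)
Definition pow_layer s : set A := [set a | forall P : set A, submodule P ->
  (forall i, P (xi * z ^+ i)) -> (forall i, (s <= i)%N -> P (z ^+ i)) -> P a].

Lemma pow_layer_submodule s : submodule (pow_layer s).
Proof.
split=> [P modP _ _|r a b ha hb P modP P1 P2]; first exact: modP.1.
by apply: modP.2; [exact: ha | exact: hb].
Qed.

Lemma pow_layer_scale s r a : pow_layer s a -> pow_layer s (phi r * a).
Proof. exact: (submodule_scale _ (pow_layer_submodule s)). Qed.

Lemma pow_layer_exp s i : (s <= i)%N -> pow_layer s (z ^+ i).
Proof. by move=> h P modP _; apply. Qed.

Lemma pow_layer_xi_exp s i : pow_layer s (xi * z ^+ i).
Proof. by move=> P modP h _. Qed.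

Lemma pow_layer_sub s t : (s <= t)%N -> pow_layer t `<=` pow_layer s.
Proof.
move=> st a; apply; first exact: pow_layer_submodule.
  exact: pow_layer_xi_exp.
by move=> i ti; apply: pow_layer_exp; exact: leq_trans ti.
Qed.

Lemma pow_layer_xi s a : pow_layer 0 a -> pow_layer s (xi * a).
Proof.
have modD := pow_layer_submodule s.
move=> /(_ [set a | pow_layer s (xi * a)]); apply.
- split=> [|r b c /= hb hc]; first by rewrite /= mulr0; exact: modD.1.
  by rewrite mulrDr mulrCA; exact: modD.2.
- by move=> i; apply: pow_layer_scale; exact: pow_layer_xi_exp.
- by move=> i _; exact: pow_layer_xi_exp.
Qed.

(** The layers have a common denominator: write z^i as a power of z^n, which is
    in phi(R), times z^(i mod n), whose denominator is bounded. *)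
Lemma pow_layer_denominator s a : pow_layer s a -> exists r, xi ^+ (k * n) * a = phi r.
Proof.
pose P : set A := [set a | exists r, xi ^+ (k * n) * a = phi r].
have modP : submodule P.
  split=> [|r b c [t eb] [w ec]]; first by exists 0; rewrite mulr0 rmorph0.
  exists (r * t + w); rewrite rmorphD rmorphM -eb -ec; ring.
have Pz i : P (z ^+ i).
  (* With i = q n + j, this is (x v)^q x^(k (n - j)) u^j. *)
  exists (x ^+ (i %/ n) * v ^+ (i %/ n) * (x ^+ (k * (n - i %% n)) * u ^+ (i %% n))).
  have -> : phi (x ^+ (i %/ n) * v ^+ (i %/ n) * (x ^+ (k * (n - i %% n)) * u ^+ (i %% n)))
      = (z ^+ n) ^+ (i %/ n) * (xi ^+ (k * (n - i %% n)) * (xi ^+ k * z) ^+ (i %% n)).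
    by rewrite zu zv !(rmorphM, rmorphXn) exprMn.
  have e : (k * n = k * (n - i %% n) + k * (i %% n))%N.
    by rewrite -mulnDr subnK // ltnW // ltn_mod.
  rewrite {1}(divn_eq i n) e !exprD exprMn -!exprM (mulnC n); ring.
move=> /(_ P modP); apply=> // i; exact: (submodule_scale _ modP).
Qed.

Lemma pow_layer_last a : pow_layer n a -> exists2 b, pow_layer 0 b & a = xi * b.
Proof.
have modD := pow_layer_submodule 0.
move=> /(_ [set a | exists2 b, pow_layer 0 b & a = xi * b]); apply.
- split=> [|r _ _ [b hb ->] [c hc ->]]; first by exists 0; rewrite ?mulr0 //; exact: modD.1.
  by exists (phi r * b + c); [exact: modD.2 | ring].
- by move=> i; exists (z ^+ i) => //; exact: pow_layer_exp.
- move=> i ni; exists (phi v * z ^+ (i - n)).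
    by apply: pow_layer_scale; exact: pow_layer_exp.
  by rewrite mulrA -zv -exprD subnKC.
Qed.

(** A repetition in the chain of layers propagates, and the layers beyond n are
    contained in xi times layer 0. *)
Lemma pow_layer_stable s : pow_layer s `<=` pow_layer s.+1 ->
  pow_layer s `<=` [set a | exists2 b, pow_layer 0 b & a = xi * b].
Proof.
move=> hs; suff H j : pow_layer s `<=` pow_layer (s + j)%N.
  by move=> a /(H n) h; apply: pow_layer_last; apply: pow_layer_sub h; exact: leq_addl.
have hz t : pow_layer t `<=` [set a | pow_layer t.+1 (z * a)].
  have modD := pow_layer_submodule t.+1.
  move=> a; apply.
  - split=> [|r b c /= hb hc]; first by rewrite /= mulr0; exact: modD.1.
    by rewrite mulrDr mulrCA; exact: modD.2.
  - by move=> i /=; rewrite mulrCA -exprS; exact: pow_layer_xi_exp.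
  - by move=> i ti /=; rewrite -exprS; exact: pow_layer_exp.
elim: j => [|j IH]; first by rewrite addn0.
rewrite addnS; apply: (subset_trans IH).
elim: j {IH} => [|j IH]; first by rewrite addn0.
rewrite addnS => a; apply.
- exact: pow_layer_submodule.
- exact: pow_layer_xi_exp.
case=> [//|i] le_i; rewrite exprS; apply: hz; apply: IH; exact: pow_layer_exp.
Qed.
End Powers.

Lemma divnS_cases (d t : nat) : (0 < d)%N ->
  (((t %% d).+1 < d /\ t.+1 %/ d = t %/ d /\ t.+1 %% d = (t %% d).+1) \/
   ((t %% d).+1 = d /\ t.+1 %/ d = (t %/ d).+1 /\ t.+1 %% d = 0))%N.
Proof.
move=> d0; have lt_td : (t %% d < d)%N by rewrite ltn_mod.
have e : t.+1 = (t %/ d * d + (t %% d).+1)%N by rewrite addnS -divn_eq.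
have [h|h] : ((t %% d).+1 < d \/ (t %% d).+1 = d)%N by lia.
  left; rewrite [in X in _ /\ (X /\ _)]e [in X in _ /\ (_ /\ X)]e.
  by rewrite divnMDl // modnMDl (divn_small h) (modn_small h) addn0.
right; rewrite [in X in _ /\ (X /\ _)]e [in X in _ /\ (_ /\ X)]e h.
by rewrite divnMDl // modnMDl divnn modnn d0 addn1.
Qed.

(** Let M be layer 0, the span of all powers of z. If z^(N+1) is not in
    xi A, the layers 0, ..., N + 1 and xi M form a chain with N + 2 strict
    steps. Its translates by xi^(K + j), for j < l, concatenate to a chain of
    length (N + 2) l between phi(R) and xi^(K + l) phi(R), where xi^K is a
    common denominator of M; but lengths there are at most (N + 1) (K + l),
    which is smaller for l large. The bound is independent of z. *)
Lemma root_bound N (J : nat -> set R) : J 0%N = setT ->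
  (forall i, (N <= i)%N -> J i = [set r | exists s, phi r = xi * phi s]) ->
  simple_series J ->
  forall z, (exists k u, xi ^+ k * z = phi u) ->
    (exists n v, (0 < n)%N /\ z ^+ n = xi * phi v) ->
  exists a, z ^+ N.+1 = xi * a.
Proof.
move=> J0 JN [idJ simJ] z [k [u zu]] [n [v [n0 zv]]]; apply: contrapT => zN.
pose d := N.+1; pose K := (k * n)%N; pose l := (d * K).+1.
pose D := pow_layer z.
pose G i : set A := [set a | exists2 r, J (i %% d)%N r & a = xi ^+ (i %/ d) * phi r].
pose Q t : set A := [set a | exists2 b, D (t %% d.+1)%N b & a = xi ^+ (K + t %/ d.+1) * b].
have nxiD s : (s <= d)%N -> ~ D s `<=` [set a | exists2 b, D 0%N b & a = xi * b].
  by move=> sd /(_ _ (pow_layer_exp sd)) [b _ e]; apply: zN; exists b.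
suff : (d.+1 * l <= d * (K + l))%N by rewrite /l; nia.
apply: (@length_bound _ _ phi _ G _ Q).
- move=> i a b _ [r Jr ->] Gr [s Js ->].
  have [[_ [e1 e2]]|[e [e1 e2]]] := divnS_cases i (ltn0Sn N).
    have [Jr'|] := pselect (J (i.+1 %% d)%N r).
      by case: Gr; exists r => //; rewrite /d e1.
    rewrite /d e2 => Jr'; have [t Jt] := simJ _ _ _ Jr Jr' Js; exists t; exists (s - t * r).
      by rewrite /d e2.
    by rewrite /d e1 rmorphB rmorphM; ring.
  (* The step from J N to the next block is trivial, as J N is already x R. *)
  case: Gr; move: Jr; rewrite JN; last by move: e => [->].
  move=> [w ew]; exists w; first by rewrite /d e2 J0.
  by rewrite ew /d e1 exprSr mulrA.
- move=> s; have modD := pow_layer_submodule z (s %% d.+1).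
  split=> [|r _ _ [b hb ->] [c hc ->]]; first by exists 0; rewrite ?mulr0 //; exact: modD.1.
  by exists (phi r * b + c); [exact: modD.2 | ring].
- move=> s _; have [[h [e1 e2]]|[e [e1 e2]]] := divnS_cases s (ltn0Sn d).
    split.
      move=> _ [b hb ->]; exists b; last by rewrite e1.
      by apply: pow_layer_sub hb; rewrite e2.
    move=> sub; apply: (nxiD (s %% d.+1)%N); first by lia.
    apply: (pow_layer_stable zv) => b hb.
    have [|c hc] := sub (xi ^+ (K + s %/ d.+1) * b); first by exists b.
    by rewrite e1 => /xiXI ->; rewrite -e2.
  split.
    move=> _ [b hb ->]; exists (xi * b); last by rewrite e1 addnS exprSr mulrA.
    by apply: pow_layer_xi; move: hb; rewrite e2.
  move=> sub; apply: (nxiD d); first by []; move=> b hb.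
  have [|c hc] := sub (xi ^+ (K + s %/ d.+1) * b).
    by exists b => //; move: e => [->].
  by rewrite e1 addnS exprSr -mulrA => /xiXI ->; exists c => //; rewrite -e2.
- move=> _ [b hb ->]; rewrite div0n addn0.
  have [r ->] := pow_layer_denominator n0 zu zv hb.
  by exists r; rewrite ?mod0n ?J0 // div0n expr0 mul1r.
- move=> _ [r _ ->]; rewrite mulKn //; exists (phi r).
    rewrite -[phi r]mulr1; apply: pow_layer_scale.
    by rewrite -(expr0 z); apply: pow_layer_exp; rewrite modnMr.
  by rewrite mulKn.
Qed.
End RootBound.

(** * Witt vectors in characteristic p *)

Section WittVectors.
Context (p : nat) (pr : prime p).

Section GhostIdentities.
Context (A : comNzRingType).
Implicit Types (a : nat -> A) (u : A).

Let expn_neq0 k : (p ^ k == 0)%N = false.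
Proof. by apply: gtn_eqF; rewrite expn_gt0 prime_gt0. Qed.

Lemma ghost_scale u a n :
  ghost p (fun i => u ^+ (p ^ i) * a i) n = u ^+ (p ^ n) * ghost p a n.
Proof.
rewrite /ghost mulr_sumr; apply: eq_bigr => i _; rewrite exprMn -exprM -expnD subnKC.
  by rewrite mulrCA.
by rewrite -ltnS.
Qed.

Lemma ghost_split a k n :
  ghost p a n = ghost p (fun i => if (i < k)%N then a i else 0) n +
                ghost p (fun i => if (i < k)%N then 0 else a i) n.
Proof.
rewrite /ghost -big_split; apply: eq_bigr => i _ /=; rewrite -mulrDr; congr (_ * _).
by case: ifP => _; rewrite expr0n expn_neq0 ?addr0 ?add0r.
Qed.

(** This expresses that p is the composite of Frobenius and Verschiebung, up to
    the term p^(n+1) a_n. *)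
Lemma ghost_shift a n :
  congm (p ^ n.+1) (ghost p a n *+ p)
    (ghost p (fun i => if i is j.+1 then a j ^+ p else 0) n).
Proof.
exists (a n); rewrite ghost_recr /ghost big_ord_recl expr0n expn_neq0 mulr0 add0r.
rewrite mulrnDl -[X in X + _]mulr_natl mulr_sumr; congr (_ + _).
  apply: eq_bigr => i _; rewrite /= mulrA -natrM -expnS -exprM -expnS.
  by rewrite subnSK.
by rewrite expnS natrM -mulrA [RHS]mulr_natl.
Qed.
End GhostIdentities.

Lemma wghost_mulrn (A : comNzRingType) (a : witt pr A) k n :
  wghost (a *+ k) n = wghost a n *+ k.
Proof.
elim: k => [|k IH]; first by rewrite !mulr0n -[0 in LHS]/(witt_zero pr A) wghost0.
by rewrite !mulrS -[a + _]/(witt_add a (a *+ k)) wghostD IH.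
Qed.

Lemma witt_map_mulrn (A B : comNzRingType) (g : {rmorphism A -> B}) (a : witt pr A) k :
  witt_map g (a *+ k) = witt_map g a *+ k.
Proof.
elim: k => [|k IH]; first by rewrite !mulr0n; exact: witt_map_zero.
by rewrite !mulrS -[a + _]/(witt_add a (a *+ k)) witt_map_add IH.
Qed.

Definition teich (A : comNzRingType) (u : A) : witt pr A :=
  Witt pr (fun n => if n is 0 then u else 0).

Lemma wghost_teich (A : comNzRingType) (u : A) n : wghost (teich u) n = u ^+ (p ^ n).
Proof.
rewrite /wghost /ghost big_ord_recl big1 ?addr0 => [|i _] /=; first by rewrite subn0 mul1r.
by rewrite expr0n gtn_eqF ?mulr0 // expn_gt0 prime_gt0.
Qed.

(** Checked on ghost components for indeterminate u and a. *)
Lemma teich_mulE (A : comNzRingType) (u : A) (a : witt pr A) :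
  teich u * a = Witt pr (fun n => u ^+ (p ^ n) * wcoef a n).
Proof.
pose g : {rmorphism Zpoly (option nat) -> A} :=
  Zeval (fun i => if i is Some n then wcoef a n else u).
pose U : Zpoly (option nat) := Zvar None.
pose b : witt pr (Zpoly (option nat)) := Witt pr (fun n => Zvar (Some n)).
have -> : teich u = witt_map g (teich U).
  by apply: wittP => -[|n] /=; [rewrite /g Zeval_var | rewrite rmorph0].
have {1}-> : a = witt_map g b by apply: wittP => n; rewrite /= Zeval_var.
rewrite -[_ * _]/(witt_mul _ _) -witt_map_mul.
have -> : witt_mul (teich U) b = Witt pr (fun n => U ^+ (p ^ n) * wcoef b n).
  apply: wghost_inj => n; rewrite wghostM wghost_teich; exact/esym/ghost_scale.
by apply: wittP => n; rewrite /= rmorphM rmorphXn /= !Zeval_var.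
Qed.

Lemma teichM (A : comNzRingType) (u v : A) : teich (u * v) = teich u * teich v.
Proof.
rewrite teich_mulE; apply: wittP => -[|n] /=; first by rewrite expn0 expr1.
by rewrite mulr0.
Qed.

Lemma teichX (A : comNzRingType) (u : A) k : teich (u ^+ k) = teich u ^+ k.
Proof.
elim: k => [|k IH]; last by rewrite !exprS teichM IH.
by rewrite !expr0; apply: wittP => -[].
Qed.

Lemma witt_split (A : comNzRingType) (a : nat -> A) k :
  Witt pr a = Witt pr (fun n => if (n < k)%N then a n else 0)
            + Witt pr (fun n => if (n < k)%N then 0 else a n).
Proof.
pose g : {rmorphism Zpoly nat -> A} := Zeval a.
pose X n : Zpoly nat := Zvar n.
have e : Witt pr X = witt_add (Witt pr (fun n => if (n < k)%N then X n else 0))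
                              (Witt pr (fun n => if (n < k)%N then 0 else X n)).
  apply: wghost_inj => n; rewrite wghostD; exact: ghost_split.
have -> : Witt pr a = witt_map g (Witt pr X) by apply: wittP => n; rewrite /= Zeval_var.
rewrite e witt_map_add; congr witt_add; apply: wittP => n /=;
  by case: ifP => _; rewrite ?Zeval_var ?rmorph0.
Qed.

Let congm_cancel (B : comNzRingType) (s s' c d a b y z : B) :
  s + c * a = s' + c * b + d * c * z -> s = s' + d * c * y ->
  c * a = c * (b + d * (z - y)).
Proof.
move=> e ey; have -> : c * a = s + c * a - s by ring.
by rewrite e ey; ring.
Qed.

(** Witt components are congruent modulo p as soon as the n-th ghost components
    are congruent modulo p^(n+1). *)
Lemma ghost_congm (I : choiceType) (a b : nat -> Zpoly I) :
  (forall n, congm (p ^ n.+1) (ghost p a n) (ghost p b n)) ->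
  forall n, congm p (a n) (b n).
Proof.
move=> h; elim/ltn_ind => n IH; have := h n.
rewrite (ghost_recr p a n) (ghost_recr p b n) => -[z e].
have [y ey] : congm (p ^ n.+1) (\sum_(i < n) (p ^ i)%:R * a i ^+ (p ^ (n - i)))
                      (\sum_(i < n) (p ^ i)%:R * b i ^+ (p ^ (n - i))).
  apply: congm_sum => i; have lt_in := ltn_ord i.
  have -> : (p ^ n.+1 = p ^ i * p ^ (0 + (n - i)).+1)%N.
    by rewrite -expnD; congr expn; lia.
  by apply: congmMl; apply: (congmXpn pr); rewrite expn1; exact: IH.
exists (z - y); apply: (@Zpoly_natI I (p ^ n)); first by rewrite expn_gt0 prime_gt0.
rewrite expnS natrM in e ey.
rewrite (congm_cancel e ey); reflexivity.
Qed.

(** The ghost components of p a and of V F a are congruent modulo p^(n+1), so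
    for indeterminate a their Witt components agree modulo p. *)
Lemma witt_natp (A : comNzRingType) (chA : p \in [pchar A]) (a : witt pr A) :
  a *+ p = Witt pr (fun n => if n is m.+1 then wcoef a m ^+ p else 0).
Proof.
pose g : {rmorphism Zpoly nat -> A} := Zeval (wcoef a).
pose X : witt pr (Zpoly nat) := Witt pr (fun n => Zvar n).
have -> : a *+ p = witt_map g (X *+ p).
  by rewrite witt_map_mulrn; congr (_ *+ _); apply: wittP => n; rewrite /= Zeval_var.
pose Y n : Zpoly nat := if n is m.+1 then wcoef X m ^+ p else 0.
have h : forall n, congm p (wcoef (X *+ p) n) (Y n).
  apply: ghost_congm => n; rewrite -/(wghost (X *+ p) n) wghost_mulrn; exact: ghost_shift.
apply: wittP => n /=; have [z ->] := h n.
rewrite rmorphD rmorphM rmorph_nat (pcharf0 chA) mul0r addr0.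
by case: n {h z} => [|n] /=; rewrite ?rmorph0 // rmorphXn /= Zeval_var.
Qed.

Lemma witt_natXp (A : comNzRingType) (chA : p \in [pchar A]) (a : witt pr A) k :
  a *+ (p ^ k) =
  Witt pr (fun n => if (n < k)%N then 0 else wcoef a (n - k)%N ^+ (p ^ k)).
Proof.
elim: k => [|k IH].
  by rewrite expn0 mulr1n; apply: wittP => n /=; rewrite subn0 expr1.
rewrite expnSr mulrnA IH witt_natp //; apply: wittP => -[|n] //=; rewrite ltnS subSS.
by case: ifP => _; rewrite ?expr0n ?gtn_eqF ?prime_gt0 // -exprM.
Qed.

(** Reduction W(A) -> A; its kernel is p W(A) when A is perfect of characteristic
    p. *)
Definition wres (A : comNzRingType) (a : witt pr A) : A := wcoef a 0.

Lemma wcoef0_ghost (A : comNzRingType) (a : witt pr A) : wcoef a 0 = wghost a 0.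
Proof. by rewrite /wghost /ghost big_ord1 expn0 expr1 mul1r. Qed.

Lemma wres_zmod_morphism (A : comNzRingType) : zmod_morphism (@wres A).
Proof.
move=> a b; rewrite /wres !wcoef0_ghost -[a - b]/(witt_add a (witt_neg b)).
by rewrite wghostD wghostN.
Qed.

Lemma wres_monoid_morphism (A : comNzRingType) : monoid_morphism (@wres A).
Proof.
by split=> [//|a b]; rewrite /wres !wcoef0_ghost -wghostM.
Qed.

HB.instance Definition _ (A : comNzRingType) :=
  GRing.isZmodMorphism.Build (witt pr A) A (@wres A) (@wres_zmod_morphism A).
HB.instance Definition _ (A : comNzRingType) :=
  GRing.isMonoidMorphism.Build (witt pr A) A (@wres A) (@wres_monoid_morphism A).

End WittVectors.

(** * Fractional powers and the sparse Witt vector *)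

Section Perfect.
Context (p : nat) (pr : prime p) (A : comNzRingType) (chA : p \in [pchar A]).
Variable root : A -> A.
Hypothesis rootK : forall a, root a ^+ p = a.
Hypothesis frobI : forall a b : A, a ^+ p = b ^+ p -> a = b.
Variable xi : A.
Hypothesis regxi : forall a, xi * a = 0 -> a = 0.

Lemma iter_rootK k (a : A) : iter k root a ^+ (p ^ k) = a.
Proof. by elim: k => [|k IH] //; rewrite iterS expnS exprM rootK. Qed.

Lemma frobXI k (a b : A) : a ^+ (p ^ k) = b ^+ (p ^ k) -> a = b.
Proof. by elim: k => [|k IH] //; rewrite expnSr !exprM => /frobI. Qed.

Section Teichmuller.
Local Notation W := (witt pr A).
Local Notation teich := (@teich p pr A).

Lemma teich_dvdP u (h : W) :
  (exists f, h = teich u * f) <-> forall n, exists b, wcoef h n = u ^+ (p ^ n) * b.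
Proof.
split=> [[f ->] n|/choice[b hb]]; first by exists (wcoef f n); rewrite teich_mulE.
by exists (Witt pr b); rewrite teich_mulE; apply: wittP => n; rewrite hb.
Qed.

(** W / [u] W is p-torsion free: in Witt components, divisibility of p^k h by [u]
    says that u^(p^(n+k)) divides h_n^(p^k), and p^k-th roots can be taken. *)
Lemma teich_dvd_natXp u (h : W) k :
  (exists f, h *+ (p ^ k) = teich u * f) -> exists f, h = teich u * f.
Proof.
move=> /teich_dvdP hu; apply/teich_dvdP => n; have [b] := hu (n + k)%N.
rewrite witt_natXp //= ltnNge leq_addl addnK /= => e.
exists (iter k root b); apply: (@frobXI k).
by rewrite e exprMn iter_rootK -exprM -expnD.
Qed.

Lemma teichI u (h h' : W) : (forall a, u * a = 0 -> a = 0) ->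
  teich u * h = teich u * h' -> h = h'.
Proof.
move=> regu e; have regX k a : u ^+ k * a = 0 -> a = 0.
  by elim: k => [|k IH]; rewrite ?expr0 ?mul1r // exprS -mulrA => /regu.
apply: wittP => n; apply: subr0_eq; apply: (regX (p ^ n)%N).
have := congr1 (fun h : W => wcoef h n) e; rewrite !teich_mulE /= => en.
by rewrite mulrBr en subrr.
Qed.
End Teichmuller.

Section Exponents.

(** The nonnegative elements of Z[1/p]. *)
Definition padic_frac (e : rat) : Prop := exists k m : nat, e = m%:R / (p ^ k)%:R.

(** xi^e, computed from any expression of e as m / p^k; [xpowE] shows that the
    choice is immaterial. *)
Definition xpow (e : rat) : A :=
  xget 0 [set a | exists k m : nat, e = m%:R / (p ^ k)%:R /\ a = iter k root xi ^+ m].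

Let pX0 k : (p ^ k)%:R != 0 :> rat.
Proof. by rewrite pnatr_eq0 -lt0n expn_gt0 prime_gt0. Qed.

Lemma iter_rootD k j (a : A) : iter (k + j) root a ^+ (p ^ j) = iter k root a.
Proof. by apply: (@frobXI k); rewrite -exprM -expnD addnC !iter_rootK. Qed.

Lemma xpowE k m : xpow (m%:R / (p ^ k)%:R) = iter k root xi ^+ m.
Proof.
rewrite /xpow; case: xgetP => [_ -> [l [n [e ->]]]|/(_ (iter k root xi ^+ m))]; last first.
  by case; exists k, m.
have {}e : (m * p ^ l = n * p ^ k)%N.
  by apply/eqP; rewrite -(eqr_nat rat) !natrM -eqr_div // e.
by rewrite -(iter_rootD l k) -(iter_rootD k l) -!exprM addnC mulnC -e mulnC.
Qed.

Lemma padic_frac_nat n : padic_frac n%:R.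
Proof. by exists 0%N, n; rewrite expn0 divr1. Qed.

Lemma padic_frac_common e f : padic_frac e -> padic_frac f -> exists k m n : nat,
  e = m%:R / (p ^ k)%:R /\ f = n%:R / (p ^ k)%:R.
Proof.
move=> [k [m ->]] [l [n ->]]; exists (k + l)%N, (m * p ^ l)%N, (n * p ^ k)%N.
by rewrite expnD !natrM; split; field; rewrite ?pX0 //; apply/andP; split.
Qed.

Lemma padic_fracD e f : padic_frac e -> padic_frac f -> padic_frac (e + f).
Proof.
move=> pe pf; have [k [m [n [-> ->]]]] := padic_frac_common pe pf.
by exists k, (m + n)%N; rewrite natrD mulrDl.
Qed.

Lemma padic_fracB e f : padic_frac e -> padic_frac f -> f <= e -> padic_frac (e - f).
Proof.
move=> pe pf; have [k [m [n [-> ->]]]] := padic_frac_common pe pf.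
rewrite ler_pM2r ?invr_gt0 ?ltr0n ?expn_gt0 ?prime_gt0 // ler_nat => nm.
by exists k, (m - n)%N; rewrite natrB // mulrBl.
Qed.

Lemma padic_fracM e f : padic_frac e -> padic_frac f -> padic_frac (e * f).
Proof.
move=> [k [m ->]] [l [n ->]]; exists (k + l)%N, (m * n)%N.
by rewrite expnD !natrM; field; rewrite !pX0.
Qed.

Lemma xpowD e f : padic_frac e -> padic_frac f -> xpow (e + f) = xpow e * xpow f.
Proof.
move=> pe pf; have [k [m [n [-> ->]]]] := padic_frac_common pe pf.
by rewrite -mulrDl -natrD !xpowE exprD.
Qed.

Lemma xpow1 : xpow 1 = xi.
Proof. by have := xpowE 0 1; rewrite expn0 divr1 expr1. Qed.

Lemma xpowM e n : padic_frac e -> xpow (n%:R * e) = xpow e ^+ n.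
Proof.
move=> [k [m ->]]; rewrite mulrA -natrM !xpowE.
by rewrite mulnC exprM.
Qed.

Lemma xpow_reg e : padic_frac e -> forall a, xpow e * a = 0 -> a = 0.
Proof.
move=> [k [m ->]] a; rewrite xpowE; set y := iter k root xi.
have regy b : y * b = 0 -> b = 0.
  move=> yb; apply: regxi; rewrite -(iter_rootK k xi) -/y.
  have : (0 < p ^ k)%N by rewrite expn_gt0 prime_gt0.
  by case: (p ^ k)%N => // q _; rewrite exprSr -mulrA yb mulr0.
by elim: m => [|m IH]; rewrite ?expr0 ?mul1r // exprS -mulrA => /regy.
Qed.

Lemma xpowI e a b : padic_frac e -> xpow e * a = xpow e * b -> a = b.
Proof.
by move=> pe h; apply: subr0_eq; apply: (xpow_reg pe); rewrite mulrBr h subrr.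
Qed.
End Exponents.

(** The gaps 3^n grow so fast that tau (n + 1) = tau n ^ 3 is negligible against
    tau n even after multiplication by 1 / tau n. The limit c of [gap_sum] satisfies
    gap_sum n < c < gap_upper n. *)
Definition tau (n : nat) : rat := (p ^ (3 ^ n))%:R^-1.
Definition gap_sum (n : nat) : rat := \sum_(i < n) tau i.
Definition gap_upper (n : nat) : rat := gap_sum n + 2%:R * tau n.

Lemma tau_gt0 n : 0 < tau n.
Proof. by rewrite invr_gt0 ltr0n expn_gt0 prime_gt0. Qed.

Lemma tau_le_half n : 2%:R * tau n <= 1.
Proof.
rewrite /tau ler_pdivrMr ?mul1r ?ltr0n ?expn_gt0 ?prime_gt0 // ler_nat.
by apply: (leq_trans (prime_gt1 pr)); rewrite -{1}(expn1 p) leq_exp2l ?prime_gt1 // expn_gt0.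
Qed.

Lemma tauS n : tau n.+1 = tau n ^+ 3.
Proof. by rewrite /tau expnSr expnM natrX exprVn. Qed.

Lemma padic_tau n : padic_frac (tau n).
Proof. by exists (3 ^ n)%N, 1%N; rewrite div1r. Qed.

Lemma gap_sumS n : gap_sum n.+1 = gap_sum n + tau n.
Proof. by rewrite /gap_sum big_ord_recr. Qed.

Lemma padic_gap_sum n : padic_frac (gap_sum n).
Proof.
elim: n => [|n IH]; first by rewrite /gap_sum big_ord0; exact: (padic_frac_nat 0).
by rewrite gap_sumS; apply: padic_fracD => //; exact: padic_tau.
Qed.

Lemma padic_gap_upper n : padic_frac (gap_upper n).
Proof.
apply: padic_fracD; first exact: padic_gap_sum.
by apply: padic_fracM; [exact: padic_frac_nat | exact: padic_tau].
Qed.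

Lemma gap_sum_mono m k : gap_sum m <= gap_sum (m + k).
Proof.
elim: k => [|k IH]; first by rewrite addn0.
by rewrite addnS gap_sumS; have := tau_gt0 (m + k); lra.
Qed.

Lemma gap_upperS n : gap_upper n.+1 <= gap_upper n.
Proof.
rewrite /gap_upper gap_sumS tauS; have := tau_gt0 n; have := tau_le_half n.
move: (tau n) => t; nra.
Qed.

Lemma gap_upper_anti m k : gap_upper (m + k) <= gap_upper m.
Proof.
elim: k => [|k IH]; first by rewrite addn0.
by rewrite addnS; apply: le_trans (gap_upperS _) IH.
Qed.

Lemma gap_sum_le_gap_upper m n : gap_sum m <= gap_upper n.
Proof.
apply: (le_trans (gap_sum_mono m n)); apply: le_trans (gap_upper_anti n m).
rewrite addnC /gap_upper; have := tau_gt0 (n + m); lra.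
Qed.

Lemma gap_upper_le1 n : gap_upper n <= 1.
Proof.
apply: (le_trans (gap_upper_anti 0 n)).
by rewrite /gap_upper /gap_sum big_ord0 add0r tau_le_half.
Qed.

Lemma gap_sum_le1 n : gap_sum n <= 1.
Proof. exact: le_trans (gap_sum_le_gap_upper n 0) (gap_upper_le1 0). Qed.

Section SparseWittVector.
Local Notation W := (witt pr A).
Local Notation teich := (@teich p pr A).

(** The series sum_m p^m [xi^(1 - gap_sum m)]; the exponent p^m turns Teichmuller
    coefficients into Witt components. *)
Definition sparse_witt : W := Witt pr (fun m => xpow (1 - gap_sum m) ^+ (p ^ m)).

Let pad1 : padic_frac 1. Proof. exact: (padic_frac_nat 1). Qed.

Lemma sparse_witt_upper n : exists f, sparse_witt * teich (xpow (gap_upper n)) = teich xi * f.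
Proof.
rewrite mulrC; apply/teich_dvdP => m; exists (xpow (gap_upper n - gap_sum m) ^+ (p ^ m)).
have pc := padic_gap_sum m; have pe := padic_gap_upper n.
rewrite teich_mulE /= -!exprMn -[xi]xpow1 -!xpowD //.
- by congr (xpow _ ^+ _); ring.
- by apply: padic_fracB => //; exact: gap_sum_le_gap_upper.
- by apply: padic_fracB => //; exact: gap_sum_le1.
Qed.

Let exprB_mod (B : comNzRingType) (a b : B) k : exists q, (a - b) ^+ k = a * q + (- b) ^+ k.
Proof.
have := subrXX (a - b) (- b) k; rewrite opprK addrNK => e.
by exists (\sum_(i < k) (a - b) ^+ (k.-1 - i) * (- b) ^+ i); rewrite -e subrK.
Qed.

Let tau_natM n : (p ^ (3 ^ n))%:R * tau n = 1.
Proof. by rewrite /tau mulfV // pnatr_eq0 -lt0n expn_gt0 prime_gt0. Qed.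

(** With E = gap_upper (n+1), dividing by [xi^(1 - E)] turns the hypothesis into
    G h = [xi^E] f, where G = sum_m p^m [xi^(E - gap_sum m)]. Its first n + 1
    terms form s, which is divisible by [xi^(E - gap_sum n)], hence s^K is
    divisible by [xi^E] for K = p^(3^n); the remaining terms are p^(n+1) G'.
    Modulo [xi^E] one has (p^(n+1) G')^K h = (G - s)^K h = 0, and the power of p
    can be cancelled. Reducing G'^K h modulo p leaves h_0 times
    xi^(K (E - gap_sum (n+1))), whose exponent is only 2 tau_n^2. *)
Lemma sparse_witt_colon n (h f : W) : sparse_witt * h = teich xi * f ->
  exists b, wres h = xpow (gap_sum n + 2%:R * tau n.+1) * b.
Proof.
move=> gh; pose E := gap_upper n.+1; pose K := (p ^ (3 ^ n))%N.
have pE : padic_frac E := padic_gap_upper _; have pc m := padic_gap_sum m.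
have pEc m : padic_frac (E - gap_sum m) by apply: padic_fracB => //; exact: gap_sum_le_gap_upper.
have p1E : padic_frac (1 - E) by apply: padic_fracB => //; exact: gap_upper_le1.
have EE : E = gap_sum n + tau n + 2%:R * tau n ^+ 3 by rewrite /E /gap_upper gap_sumS tauS.
have t0 := tau_gt0 n; have t1 := tau_le_half n.
pose G : W := Witt pr (fun m => xpow (E - gap_sum m) ^+ (p ^ m)).
have gE : sparse_witt = teich (xpow (1 - E)) * G.
  rewrite teich_mulE; apply: wittP => m /=.
  by rewrite -exprMn -xpowD //; congr (xpow _ ^+ _); ring.
have Gh : G * h = teich (xpow E) * f.
  apply: (@teichI (xpow (1 - E))); first exact: xpow_reg.
  rewrite mulrA -gE gh mulrA -teichM -xpowD // subrK.
  by rewrite xpow1.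
pose s : W := Witt pr (fun i => if (i < n.+1)%N then wcoef G i else 0).
pose G' : W := Witt pr (fun i => iter n.+1 root (wcoef G (i + n.+1)%N)).
have Gs : G - s = G' *+ (p ^ n.+1).
  have -> : G = s + G' *+ (p ^ n.+1); last by rewrite addrC addKr.
  rewrite witt_natXp // [LHS](witt_split pr (wcoef G) n.+1); congr (_ + _); apply: wittP => i /=.
  by case: ltnP => // ni; rewrite -iterS iter_rootK subnK.
have [s' es] : exists s', s = teich (xpow (E - gap_sum n)) * s'.
  apply/teich_dvdP => i /=; case: ltnP => [|_]; last by exists 0; rewrite mulr0.
  rewrite ltnS => le_in; exists (xpow (gap_sum n - gap_sum i) ^+ (p ^ i)).
  have le_c : gap_sum i <= gap_sum n by have := gap_sum_mono i (n - i); rewrite subnKC.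
  rewrite -exprMn -xpowD //; last exact: padic_fracB.
  by congr (xpow _ ^+ _); ring.
have [s'' eK] : exists s'', s ^+ K = teich (xpow E) * s''.
  exists (teich (xpow (K%:R * (E - gap_sum n) - E)) * s' ^+ K).
  have pK : padic_frac (K%:R * (E - gap_sum n)) by apply: padic_fracM => //; exact: padic_frac_nat.
  rewrite mulrA -teichM -xpowD //; last first.
    apply: padic_fracB => //; apply: le_trans (gap_upper_le1 _) _.
    by rewrite -[leLHS](tau_natM n); apply: ler_wpM2l; [exact: ler0n | rewrite EE; nra].
  by rewrite addrC subrK xpowM // es exprMn teichX.
have [q eq] := exprB_mod G s K.
have [f' ef'] : exists f', G' ^+ K * h = teich (xpow E) * f'.
  apply: (@teich_dvd_natXp _ _ (n.+1 * K)); exists (q * f + (-1) ^+ K * s'' * h).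
  have -> : (G' ^+ K * h) *+ (p ^ (n.+1 * K)) = (G - s) ^+ K * h.
    by rewrite Gs exprMn_n -expnM mulrnAl.
  rewrite eq [(- s) ^+ K]exprNn eK.
  transitivity (q * (G * h) + (-1) ^+ K * (teich (xpow E) * s'') * h); first by ring.
  by rewrite Gh; ring.
have wG : wres G' = xpow (E - gap_sum n.+1).
  by apply: (@frobXI n.+1); rewrite /wres /= -iterS iter_rootK add0n.
have {ef'} := congr1 (@wres p pr A) ef'.
rewrite !rmorphM rmorphXn => e0.
have {e0} : wres G' ^+ K * wres h = xpow E * wres f' by exact: e0.
rewrite wG -xpowM //.
(* The slack between the exponent obtained and the one claimed. *)
pose rho := tau n - 2%:R * tau n ^+ 2.
have prho : padic_frac rho.
  apply: padic_fracB; first exact: padic_tau; last by nra.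
  by do ! apply: padic_fracM; (exact: padic_frac_nat || exact: padic_tau).
have pt : padic_frac (gap_sum n + 2%:R * tau n.+1).
  by apply: padic_fracD => //; apply: padic_fracM; [exact: padic_frac_nat | exact: padic_tau].
have pKE : padic_frac (K%:R * (E - gap_sum n.+1)).
  by apply: padic_fracM => //; exact: padic_frac_nat.
have eE : E = K%:R * (E - gap_sum n.+1) + (gap_sum n + 2%:R * tau n.+1 + rho).
  have -> : K%:R * (E - gap_sum n.+1) = 2%:R * tau n ^+ 2.
    rewrite EE gap_sumS; have -> : gap_sum n + tau n + 2%:R * tau n ^+ 3 - (gap_sum n + tau n)
      = tau n * (2%:R * tau n ^+ 2) by ring.
    by rewrite mulrA tau_natM mul1r.
  by rewrite EE tauS /rho; ring.
rewrite [X in _ = xpow X * _]eE (xpowD pKE (padic_fracD pt prho)) (xpowD pt prho).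
by rewrite -!mulrA => /(xpowI pKE) ->; exists (xpow rho * wres f').
Qed.
End SparseWittVector.
End Perfect.

(** * Syzygies over a coherent ring *)

Section Syzygies.
Context (R : comNzRingType).

Section Lincomb.
Context (M : lmodType R).
Implicit Types (S : set M).

Lemma lincombD n (s : 'I_n -> M) b c : lincomb s (b + c) = lincomb s b + lincomb s c.
Proof. by rewrite /lincomb -big_split; apply: eq_bigr => i _; rewrite mxE scalerDl. Qed.

Lemma lincombZ n (s : 'I_n -> M) r c : lincomb s (r *: c) = r *: lincomb s c.
Proof. by rewrite /lincomb scaler_sumr; apply: eq_bigr => i _; rewrite mxE scalerA. Qed.

Lemma lincomb0 n (s : 'I_n -> M) : lincomb s 0 = 0.
Proof. by rewrite -(scale0r 0) lincombZ scale0r. Qed.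

Lemma lincomb_sum n (s : 'I_n -> M) k (F : 'I_k -> 'rV[R]_n) :
  lincomb s (\sum_i F i) = \sum_i lincomb s (F i).
Proof. by apply: (big_morph (lincomb s)); [exact: lincombD | exact: lincomb0]. Qed.

Lemma lincomb_mulmx n m (s : 'I_n -> M) (t : 'I_m -> M) (U : 'M_(n, m)) c :
  (forall i, s i = lincomb t (row i U)) -> lincomb t (c *m U) = lincomb s c.
Proof.
move=> sU; rewrite mulmx_sum_row lincomb_sum; apply: eq_bigr => i _.
by rewrite lincombZ sU.
Qed.

Lemma lincomb_in_range n m (s : 'I_n -> M) (t : 'I_m -> M) :
  range (lincomb s) `<=` range (lincomb t) ->
  exists U : 'M_(n, m), forall i, s i = lincomb t (row i U).
Proof.
move=> st; have /choice[u hu] : forall i, exists c, s i = lincomb t c.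
  move=> i; have [|c _ <-] := st (s i); last by exists c.
  exists (delta_mx 0 i) => //; rewrite /lincomb (bigD1 i) //= mxE !eqxx scale1r.
  by rewrite big1 ?addr0 // => j /negbTE ji; rewrite mxE eqxx ji scale0r.
by exists (\matrix_i u i) => i; rewrite rowK.
Qed.

(** Finite presentation does not depend on the generators: if s = U t and
    t = V s, the syzygies of t are generated by the g U, for g a syzygy of s,
    and by the rows of 1 - V U. *)
Lemma syzygies_fg S m (t : 'I_m -> M) : finitely_presented S -> S = range (lincomb t) ->
  finitely_generated [set c : 'rV[R]_m | lincomb t c = 0].
Proof.
move=> [n [s [-> [k [g eg]]]]] est.
have [U sU] : exists U : 'M_(n, m), forall i, s i = lincomb t (row i U).
  by apply: lincomb_in_range; rewrite est.
have [V tV] : exists V : 'M_(m, n), forall j, t j = lincomb s (row j V).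
  by apply: lincomb_in_range; rewrite -est.
exists (k + m)%N, (fun i => match fintype.split i with
  | inl i => g i *m U | inr j => row j (1%:M - V *m U) end).
have e (d : 'rV[R]_(k + m)) : lincomb (fun i => match fintype.split i with
    | inl i => g i *m U | inr j => row j (1%:M - V *m U) end) d =
    lincomb g (lsubmx d) *m U + rsubmx d *m (1%:M - V *m U).
  rewrite [LHS]/lincomb big_split_ord /=; congr (_ + _).
    rewrite /lincomb mulmx_suml; apply: eq_bigr => i _.
    by rewrite (unsplitK (inl i)) mxE -scalemxAl.
  rewrite mulmx_sum_row; apply: eq_bigr => j _.
  by rewrite (unsplitK (inr j)) mxE.
apply/seteqP; split=> c /=.
  move=> tc; have : range (lincomb g) (c *m V) by rewrite -eg /= (lincomb_mulmx _ tV).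
  move=> [d _ ed]; exists (row_mx d c) => //.
  by rewrite e row_mxKl row_mxKr ed mulmxBr mulmx1 mulmxA addrC subrK.
move=> [d _ <-]; rewrite e lincombD (lincomb_mulmx _ sU).
have -> : lincomb s (lincomb g (lsubmx d)) = 0.
  have : range (lincomb g) (lincomb g (lsubmx d)) by exists (lsubmx d).
  by rewrite -eg.
rewrite add0r mulmxBr mulmx1 lincombD -scaleN1r lincombZ mulmxA.
by rewrite (lincomb_mulmx _ sU) (lincomb_mulmx _ tV) scaleN1r subrr.
Qed.
End Lincomb.

(** The colon ideal (a : b) is the projection of the syzygies of (a, b) to the
    second coordinate. *)
Lemma coherent_colon (a b : R) : coherent R -> exists k (h : 'I_k -> R),
  (forall i, exists f, b * h i = a * f) /\
  forall h0 f0, b * h0 = a * f0 -> exists c : 'I_k -> R, h0 = \sum_i c i * h i.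
Proof.
move=> cohR; pose t (i : 'I_2) : R^o := if i == 0 then a else b.
have tE (c : 'rV[R]_2) : lincomb t c = c 0 0 * a + c 0 1 * b.
  rewrite /lincomb big_ord_recl big_ord1 /t /=.
  by have -> : lift ord0 ord0 = 1 :> 'I_2 by apply/val_inj.
have [k [g eg]] := @syzygies_fg R^o (range (lincomb t)) 2 t
  (cohR _ (ex_intro _ 2%N (ex_intro _ t erefl))) erefl.
exists k, (fun i => g i 0 1); split=> [i|h0 f0 e].
  have : [set c | lincomb t c = 0] (g i).
    rewrite eg; exists (delta_mx 0 i) => //; rewrite /lincomb (bigD1 i) //= mxE !eqxx scale1r.
    by rewrite big1 ?addr0 // => j /negbTE ji; rewrite mxE eqxx ji scale0r.
  rewrite /= tE => /eqP; rewrite addr_eq0 => /eqP e; exists (- g i 0 0).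
  by rewrite mulrC -[LHS]opprK -e; ring.
have : [set c | lincomb t c = 0] (\row_j if j == 0 then - f0 else h0).
  by rewrite /= tE !mxE /= (mulrC h0) e; ring.
rewrite eg => -[d _ /(congr1 (fun c : 'rV[R]_2 => c 0 1))].
rewrite mxE /= => <-; exists (fun i => d 0 i).
by rewrite /lincomb summxE; apply: eq_bigr => i _; rewrite mxE.
Qed.
End Syzygies.

(** * Failure of coherence *)

Section NotCoherent.
Context (R A : comNzRingType) (phi : {rmorphism R -> A}) (p : nat) (pr : prime p).
Hypothesis noethR : noetherian R.
Hypothesis locR : local_ring R.
Hypothesis dimR : krull_dim_eq R 1.
Hypothesis chA : p \in [pchar A].
Hypothesis phi_nil : forall r, phi r = 0 -> exists n, r ^+ n = 0.
Hypothesis phi_pow : forall a, exists k r, a ^+ (p ^ k) = phi r.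
Hypothesis frobI : forall a b : A, a ^+ p = b ^+ p -> a = b.
Variable root : A -> A.
Hypothesis rootK : forall a, root a ^+ p = a.

Let frobX_sum k n (F : 'I_n -> A) :
  (\sum_i F i) ^+ (p ^ k) = \sum_i F i ^+ (p ^ k).
Proof.
elim: k => [|k IH]; first by rewrite expn0 expr1; apply: eq_bigr => i _; rewrite expr1.
rewrite expnSr exprM IH -(pFrobenius_autE chA) rmorph_sum.
by apply: eq_bigr => i _; rewrite exprM -(pFrobenius_autE chA).
Qed.

Lemma gap_sum_denominator n : exists m : nat, (p ^ (3 ^ n))%:R * gap_sum p n.+1 = m%:R.
Proof.
suff H k : (k <= n.+1)%N -> exists m : nat, (p ^ (3 ^ n))%:R * gap_sum p k = m%:R by exact: H.
elim: k => [|k IH] kn; first by exists 0%N; rewrite /gap_sum big_ord0 mulr0.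
have [m em] := IH (ltnW kn); exists (m + p ^ (3 ^ n - 3 ^ k))%N.
have le3 : (3 ^ k <= 3 ^ n)%N by rewrite leq_exp2l.
rewrite gap_sumS mulrDr em natrD; congr (_ + _).
rewrite -{1}(subnK le3) expnD natrM /tau mulfK // pnatr_eq0 -lt0n expn_gt0.
by rewrite prime_gt0.
Qed.

(** Here A may be any perfect ring which is a perfection of R, that is, phi has
    nil kernel and every element of A has a p-power in the image. *)
Lemma perfection_not_coherent : ~ coherent (witt pr A).
Proof.
move=> cohW.
have redA (a : A) : a * a = 0 -> a = 0.
  move=> aa; apply: frobI; rewrite expr0n gtn_eqF ?prime_gt0 //.
  by case: p (prime_gt1 pr) => [|[|q]] // _; rewrite !exprS mulrA aa mul0r.
have [m [x [[idm m1 unitm] [mx regR primex]]]] :=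
  exists_parameter noethR locR dimR phi_nil redA.
set xi := phi x.
have regX k r : phi (r * x ^+ k) = 0 -> phi r = 0.
  by elim: k r => [|k IH] r; rewrite ?expr0 ?mulr1 // exprSr mulrA => /regR/IH.
have regxi a : xi * a = 0 -> a = 0.
  move=> xa; have [k [r er]] := phi_pow a.
  apply: (@frobXI p A frobI k); rewrite er expr0n gtn_eqF ?expn_gt0 ?prime_gt0 //.
  apply: (regX (p ^ k)%N); rewrite rmorphM rmorphXn -er -exprMn mulrC xa.
  by rewrite expr0n gtn_eqF ?expn_gt0 ?prime_gt0.
(* Only one factor xi is kept outside phi, as required by [root_bound]. *)
have pow_mem a : exists k v, (xi * a) ^+ (p ^ k) = xi * phi v.
  have [k [v ev]] := phi_pow a; exists k, (x ^+ (p ^ k).-1 * v).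
  by rewrite exprMn ev rmorphM rmorphXn mulrA -exprS prednK // expn_gt0 prime_gt0.
have unit_xi a : xi * a <> 1.
  move=> xa; have [k [v]] := pow_mem a; rewrite xa expr1n -rmorphM => e.
  have /phi_nil[n en] : phi (1 - x * v) = 0 by rewrite rmorphB rmorph1 -e subrr.
  apply: m1; rewrite -(subrK (x * v) 1); apply: ideal_add => //; last first.
    by rewrite mulrC; exact: ideal_mul.
  apply: contrapT => /unitm[s es].
  have /eqP : (1 - x * v) ^+ n * s ^+ n = 1 by rewrite -exprMn es expr1n.
  by rewrite en mul0r eq_sym oner_eq0.
pose X : set R := [set r | exists s, phi r = phi x * phi s].
have idX : ideal X.
  split=> [|a u v [s es] [t et]]; first by exists 0; rewrite !rmorph0 mulr0.
  by exists (a * s + t); rewrite !rmorphD !rmorphM es et; ring.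
have [|N [J [J0 JN simJ]]] := composition_series noethR idm unitm primex idX.
  by exists 1; rewrite rmorph1 mulr1.
have bound := root_bound regxi J0 JN simJ.
pose xp := xpow p root xi.
pose pf := padic_frac p.
have xpM j e : pf e -> xp (j%:R * e) = xp e ^+ j.
  by move=> pe; exact: xpowM.
have xpD e f : pf e -> pf f -> xp (e + f) = xp e * xp f.
  by move=> pe pf'; exact: xpowD.
have xp1 : xp 1 = xi by exact: xpow1.
have pf1 : pf 1 by exact: (padic_frac_nat _ 1).
have pM n e : pf e -> pf (n%:R * e) by move=> pe; apply: padic_fracM => //; exact: padic_frac_nat.
have ptau n : pf (tau p n) by exact: padic_tau.
have [k [h [hJ hgen]]] :=
  coherent_colon (teich pr xi) (sparse_witt pr root xi) cohW.
pose y i := wres (h i).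
have [kap [w hw]] : exists (kap : 'I_k -> nat) (w : 'I_k -> R),
    forall i, y i ^+ (p ^ kap i) = phi (w i).
  have [kap /choice[w hw]] := choice (fun i => phi_pow (y i)).
  by exists kap, w.
(* n is so large that the y_i^q are in phi(R) and that p^(N+1) tau_n < 1. *)
pose n := maxn (\max_i kap i) N.+1; pose q := (p ^ (3 ^ n))%N.
have q0 : (0 < q)%N by rewrite expn_gt0 prime_gt0.
have lt_n3 : (n < 3 ^ n)%N by exact: ltn_expl.
have yq i : exists r, y i ^+ q = phi r.
  have kn : (kap i <= 3 ^ n)%N.
    by apply: leq_trans (ltnW lt_n3); rewrite leq_max leq_bigmax.
  exists (w i ^+ (p ^ (3 ^ n - kap i))).
  by rewrite rmorphXn -hw -exprM -expnD subnKC.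
have [mm emm] := gap_sum_denominator n; rewrite -/q in emm.
have pcs : pf (gap_sum p n.+1) by exact: padic_gap_sum.
have xpq e : pf e -> xp (gap_sum p n.+1 + e) ^+ q = xi ^+ mm * xp (q%:R * e).
  move=> pe; rewrite -xpM; last exact: padic_fracD.
  rewrite mulrDr emm xpD //; last 2 first.
  - exact: padic_frac_nat.
  - exact: pM.
  by rewrite -(mulr1 mm%:R) xpM ?xp1 //; exact: pf1.
have /choice[b hb] : forall i, exists b,
    y i = xp (gap_sum p n.+1 + 2%:R * tau p n.+2) * b.
  move=> i; have [f ef] := hJ i.
  exact: (sparse_witt_colon chA rootK frobI regxi n.+1 ef).
pose z i := xp (q%:R * (2%:R * tau p n.+2)) * b i ^+ q.
have yz i : y i ^+ q = xi ^+ mm * z i.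
  by rewrite hb exprMn xpq ?mulrA //; exact: pM.
(* The z_i satisfy the hypotheses of [root_bound]: their p^(3^(n+2))-th powers
   are divisible by xi^(2 q). *)
have zN i : exists a, z i ^+ (p ^ N.+1) = xi * a.
  have [||a ea] := bound (z i).
  - by have [r er] := yq i; exists mm, r; rewrite -yz.
  - have [a ea] : exists a, z i ^+ (p ^ (3 ^ n.+2)) = xi * a.
      rewrite exprMn -xpM; last by do 2! apply: (pM).
      rewrite (_ : _ * (q%:R * _) = (2 * q)%:R * 1); last first.
        by rewrite /tau natrM; field; rewrite pnatr_eq0 -lt0n expn_gt0 prime_gt0.
      rewrite xpM ?xp1; last exact: pf1.
      have : (0 < 2 * q)%N by rewrite muln_gt0.
      case: (2 * q)%N => // j _.
      by exists (xi ^+ j * (b i ^+ q) ^+ (p ^ (3 ^ n.+2))); rewrite exprS mulrA.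
    have [l [v ev]] := pow_mem a.
    exists (p ^ (3 ^ n.+2) * p ^ l)%N, v; split; last by rewrite exprM ea.
    by rewrite muln_gt0 !expn_gt0 prime_gt0.
  have le_N : (N.+1 <= p ^ N.+1)%N by apply/ltnW/ltn_expl/prime_gt1.
  by exists (a * z i ^+ (p ^ N.+1 - N.+1)); rewrite mulrA -ea -exprD subnKC.
have [f ef] := sparse_witt_upper pr rootK frobI xi n.+1.
have [c /(congr1 (@wres p pr A))] := hgen _ _ ef.
rewrite rmorph_sum => /= e0.
have {e0} e1 : xp (gap_upper p n.+1) = \sum_i wres (c i) * y i.
  by rewrite [LHS]e0; apply: eq_bigr => i _; rewrite -rmorphM.
have e2 : xp (q%:R * (2%:R * tau p n.+1)) = \sum_i wres (c i) ^+ q * z i.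
  apply: (@xiXI _ _ phi x regxi mm); rewrite -xpq; last exact: pM.
  rewrite -/(gap_upper p n.+1) e1 frobX_sum mulr_sumr; apply: eq_bigr => i _.
  by rewrite exprMn yz mulrCA.
pose delta := (p ^ N.+1)%:R * (q%:R * (2%:R * tau p n.+1)).
have pdelta : pf delta by do 3! apply: (pM).
have [B eB] : exists B, xp delta = xi * B.
  have [a ha] := choice zN.
  exists (\sum_i (wres (c i) ^+ q) ^+ (p ^ N.+1) * a i).
  rewrite xpM; last by do 2! apply: (pM).
  rewrite e2 frobX_sum mulr_sumr; apply: eq_bigr => i _.
  by rewrite exprMn ha mulrCA.
have delta_lt1 : delta < 1.
  have qt : q%:R * tau p n = 1.
    by rewrite /tau mulfV // pnatr_eq0 -lt0n expn_gt0 prime_gt0.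
  have -> : delta = ((p ^ N.+1)%:R * tau p n) * (2%:R * tau p n).
    by rewrite /delta tauS -[tau p n in RHS]mul1r -qt; ring.
  have t0 := tau_gt0 pr n; have t1 := tau_le_half pr n.
  have lt1 : (p ^ N.+1)%:R * tau p n < 1.
    rewrite -[ltRHS]qt ltr_pM2r // ltr_nat ltn_exp2l ?prime_gt1 //.
    by apply: leq_ltn_trans lt_n3; exact: leq_maxr.
  by apply: le_lt_trans lt1; rewrite ler_piMr // mulr_ge0 // ltW.
have pd1 : pf (1 - delta).
  by apply: padic_fracB; rewrite ?ltW //; exact: pf1.
have {eB} e3 : xp (1 - delta) * B = 1.
  apply: (xpowI pr rootK frobI regxi pdelta); rewrite mulr1 mulrA -xpD //.
  by rewrite addrC subrK xp1 -eB.
have [j [[|d] ed]] := pd1; first by move: delta_lt1; rewrite mul0r in ed; lra.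
have e4 : xp (1 - delta) ^+ (p ^ j) = xi ^+ d.+1.
  by rewrite ed [xp _](xpowE pr rootK frobI) -exprM mulnC exprM (iter_rootK rootK).
apply: (unit_xi (xi ^+ d * B ^+ (p ^ j))).
by rewrite mulrA -exprS -e4 -exprMn e3 expr1n.
Qed.
End NotCoherent.

(** * The perfect closure *)

Section PerfectClosure.
Context (R : comNzRingType) (p : nat) (chRp : p \in [pchar R]).
Local Notation A := (perfect_closure chRp).
Local Notation colim_in := (colim_in (pFrobenius_aut chRp)).

Definition to_perfect_closure : R -> A := colim_in 0.

Lemma to_perfect_closure_zmod : zmod_morphism to_perfect_closure.
Proof.
move=> a b; apply: (canRL (addrK _)); rewrite -[LHS]colim_inD.
by rewrite subrK.
Qed.

Lemma to_perfect_closure_monoid : monoid_morphism to_perfect_closure.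
Proof. by split=> [|a b]; [exact: colim_in1 | exact: colim_inM]. Qed.

HB.instance Definition _ :=
  GRing.isZmodMorphism.Build R A to_perfect_closure to_perfect_closure_zmod.
HB.instance Definition _ :=
  GRing.isMonoidMorphism.Build R A to_perfect_closure to_perfect_closure_monoid.

Lemma iter_frobenius k (r : R) : iter k (pFrobenius_aut chRp) r = r ^+ (p ^ k).
Proof. by elim: k => [|k IH] //; rewrite iterS IH pFrobenius_autE -exprM expnSr. Qed.

Lemma colim_inX k (r : R) j : colim_in k r ^+ j = colim_in k (r ^+ j) :> A.
Proof.
elim: j => [|j IH]; first by rewrite !expr0; exact/esym/colim_in1.
by rewrite !exprS IH; exact/esym/colim_inM.
Qed.

Lemma colim_inXp k j (r : R) : colim_in (j + k) r ^+ (p ^ j) = colim_in k r :> A.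
Proof. by rewrite colim_inX -iter_frobenius; exact: colim_in_lift. Qed.

Lemma colim_in_eq0 k (r : R) : (colim_in k r = 0 :> A) <-> exists j, r ^+ (p ^ j) = 0.
Proof.
have z0 j : iter j (pFrobenius_aut chRp) 0 = 0 by elim: j => //= j ->; rewrite rmorph0.
split=> [/colim_in_eq[j]|[j rj]].
  by rewrite z0 iter_frobenius; exists (0 + j)%N.
apply/colim_in_eq; exists j; rewrite z0 iter_frobenius.
by rewrite add0n.
Qed.
End PerfectClosure.

Theorem mainTheorem8 (R : comNzRingType) (p : nat) (chRp : p \in [pchar R]) :
  noetherian R -> local_ring R -> krull_dim_eq R 1 ->
  ~ coherent (witt (pcharf_prime chRp) (perfect_closure chRp)).
Proof.
move=> noethR locR dimR; have pr := pcharf_prime chRp.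
set A := perfect_closure chRp.
pose phi : {rmorphism R -> A} := to_perfect_closure chRp.
have chA : p \in [pchar A] by exact: (rmorph_pchar phi).
have phi_pow (a : A) : exists k r, a ^+ (p ^ k) = phi r.
  have [k [r ->]] := colim_inP a; exists k, r.
  by have := colim_inXp chRp 0 k r; rewrite addn0.
have frobI (a b : A) : a ^+ p = b ^+ p -> a = b.
  move=> e; apply: subr0_eq; have {e} : (a - b) ^+ p = 0.
    by rewrite -(pFrobenius_autE chA) rmorphB /= !pFrobenius_autE e subrr.
  have [k [r ->]] := colim_inP (a - b); rewrite colim_inX => /colim_in_eq0[j].
  by rewrite -exprM -expnS => e; apply/colim_in_eq0; exists j.+1.
have /choice[root rootK] (a : A) : exists b : A, b ^+ p = a.
  have [k [r ->]] := colim_inP a; exists (colim_in _ k.+1 r).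
  by have := colim_inXp chRp k 1 r; rewrite expn1.
apply: (perfection_not_coherent (phi := phi) noethR locR dimR chA _ phi_pow frobI rootK).
by move=> r /colim_in_eq0[j e]; exists (p ^ j)%N.
Qed.
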